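(* Let $p$ be an odd prime, $j \in \mathbb{Z}^{+}$, $j \geq 2$, let $\varphi(k) = k$ and let $\psi_{p}$ be the derivative of the $p$-adic log gamma function on $\mathbb{C}_{p}\setminus\mathbb{Z}_{p}$. Then $$\int_{\mathcal{A}(1,0), \varphi}x^{j - 3}\,\psi_{p}'\!\left(\tfrac{1}{x}\right)dx = \frac{1 - j}{p - 1}\sum_{i = 0}^{p - 2}\delta_{i}\,L_{p}(j,\omega^{i - j + 2}),$$ where $$\delta_{i} = \sum_{\zeta^{p - 1 } = 1}\frac{\zeta^{i + 1}}{1 - \omega(1 - \zeta)},$$ the sum being over the $(p-1)$-th roots of unity $\zeta$ in $\mathbb{C}_p$.
   Context: $\mathbb{C}_p$ is the completion of an algebraic closure of $\mathbb{Q}_p$, with $|p|_p=1/p$. $\mathcal{A}(1,0)$ is the open disc $\{x\in\mathbb{C}_p:|x|_p<1\}$, regarded as the arc at $b=0$ of the circle with center $a=1$ and radius $1$. For $f:\mathcal{A}(a,b)\to\mathbb{C}_p$, the integral with respect to the path sequence $\varphi(k)=k$ is $$\int_{\mathcal{A}(a,b),\varphi}f(x)\,dx=\lim_{k\to\infty}p^{-k}\sum_{\zeta^{p^k}=1}(x-a)f(x),\qquad x=a+(b-a)\zeta,$$ if the limit exists. The $p$-adic log gamma function on $\mathbb{C}_p\setminus\mathbb{Z}_p$ is Diamond's function $G_p(x)=\lim_{k\to\infty}p^{-k}\sum_{n=0}^{p^k-1}\big((x+n)\log(x+n)-(x+n)\big)$, with $\log$ the Iwasawa $p$-adic logarithm,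 and $\psi_p=G_p'$, i.e. $\psi_p(x)=\lim_{k\to\infty}p^{-k}\sum_{n=0}^{p^k-1}\log(x+n)$. For $|x|_p>1$ one has $\psi_p'(x)=\sum_{n\ge1}B_{n-1}x^{-n}$, where the Bernoulli numbers $B_n$ are given by $te^t/(e^t-1)=\sum_n B_nt^n/n!$; accordingly the integrand $x^{j-3}\psi_p'(1/x)$ is taken at $x=0$ to have the value of its power series $\sum_{n\ge j-2}B_{n-j+2}x^n$. $\omega$ is the Teichmüller character: for $|x|_p=1$, $\omega(x)$ is the unique root of unity of order prime to $p$ with $|x-\omega(x)|_p<1$, and $\omega(x)=0$ if $|x|_p<1$; its restriction to integers is a Dirichlet character mod $p$, also denoted $\omega$. $L_p(s,\chi)$ is the Kubota–Leopoldt $p$-adic $L$-function of the Dirichlet character $\chi$, normalized by $L_p(1-n,\chi)=-(1-\chi\omega^{-n}(p)p^{n-1})B_{n,\chi\omega^{-n}}/n$ for integers $n\ge1$ (identically zero for odd $\chi$); in particular $B_n=-(1-p^{n-1})^{-1}n\,L_p(1-n,\omega^n)$ for $n\ge 2$. *)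

(* Defs.v *)
From HB Require Import structures.
From mathcomp Require Import all_boot all_order all_algebra.
From mathcomp Require Import boolp classical_sets fsbigop reals topology.
From mathcomp Require Import normedtype sequences.
From mathcomp Require Import ring.
Set Implicit Arguments.
Unset Strict Implicit.
Unset Printing Implicit Defensive.
Import Order.TTheory GRing.Theory Num.Theory.
Import numFieldNormedType.Exports.
Local Open Scope classical_set_scope.
Local Open Scope ring_scope.

(* MathComp-Analysis's normed modules have an archimedean norm, so a
   non-archimedean absolute value is a plain function v : K -> R here, and
   limits in K are real limits of v (u n - l). *)

Definition vcvg (R : realType) (K : fieldType) (v : K -> R)
    (u : nat -> K) (l : K) : Prop :=
  (fun n => v (u n - l)) @ \oo --> (0 : R).

(* 0 if there is no limit *)
Definition vlim (R : realType) (K : fieldType) (v : K -> R)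
    (u : nat -> K) : K :=
  xget 0 [set l | vcvg v u l].

Definition vcauchy (R : realType) (K : fieldType) (v : K -> R)
    (u : nat -> K) : Prop :=
  forall e : R, 0 < e ->
  exists N : nat, forall m n : nat, (N <= m)%N -> (N <= n)%N ->
    v (u m - u n) < e.

Definition vclosure (R : realType) (K : fieldType) (v : K -> R)
    (A : set K) : set K :=
  [set x | forall e : R, 0 < e -> exists2 y, A y & v (x - y) < e].

Definition is_vderiv (R : realType) (K : fieldType) (v : K -> R)
    (f : K -> K) (x d : K) : Prop :=
  forall e : R, 0 < e ->
  exists2 r : R, 0 < r &
    forall h : K, h != 0 -> v h < r -> v ((f (x + h) - f x) / h - d) < e.

(* 0 at the points where f is not differentiable *)
Definition vderiv (R : realType) (K : fieldType) (v : K -> R)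
    (f : K -> K) (x : K) : K :=
  xget 0 [set d | is_vderiv v f x d].

(* C_p is determined up to isometric isomorphism by is_Cp: in a complete
   field, the closure of Q is Q_p, the elements algebraic over Q_p form an
   algebraic closure of Q_p, and density makes K its completion. *)

Record pabs (R : realType) (K : fieldType) (p : nat) (v : K -> R) : Prop :=
  Pabs {
    pabs_ge0 : forall x, 0 <= v x;
    pabs_eq0 : forall x, v x = 0 <-> x = 0;
    pabsM : forall x y, v (x * y) = v x * v y;
    pabsD : forall x y, v (x + y) <= Num.max (v x) (v y);
    pabs_p : v p%:R = p%:R^-1 }.

Definition Qp_in (R : realType) (K : fieldType) (v : K -> R) : set K :=
  vclosure v (range (fun q : rat => ratr q : K)).

Definition Zp_in (R : realType) (K : fieldType) (v : K -> R) : set K :=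
  vclosure v (range (fun z : int => z%:~R : K)).

Definition Qpbar_in (R : realType) (K : fieldType) (v : K -> R) : set K :=
  [set x | exists P : {poly K},
     [/\ P != 0, forall i, Qp_in v P`_i & root P x]].

Record is_Cp (R : realType) (K : fieldType) (p : nat) (v : K -> R) : Prop :=
  IsCp {
    Cp_pabs : pabs p v;
    Cp_complete : forall u : nat -> K, vcauchy v u -> exists l, vcvg v u l;
    Cp_closed : forall P : {poly K}, (1 < size P)%N ->
      (forall i, Qpbar_in v P`_i) -> exists2 x, Qpbar_in v x & root P x;
    Cp_dense : vclosure v (Qpbar_in v) = setT }.

(* p^(-k) times the sum of (x - a) f(x) over x = a + (b - a) z, z^(p^k) = 1;
   the sum is finitely supported, there being at most p^k such z. *)
Definition arc_sum (K : fieldType) (p : nat) (a b : K) (f : K -> K)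
    (k : nat) : K :=
  (p%:R ^- k) *
  \sum_(z \in [set z : K | z ^+ (p ^ k) = 1])
    ((a + (b - a) * z) - a) * f (a + (b - a) * z).

(* The integral of f over the arc A(a, b), with respect to the path sequence
   phi(k) = k, exists and is equal to l. *)
Definition is_arc_integral (R : realType) (K : fieldType) (v : K -> R)
    (p : nat) (a b : K) (f : K -> K) (l : K) : Prop :=
  vcvg v (arc_sum p a b f) l.

Record iwasawa_log (R : realType) (K : fieldType) (p : nat) (v : K -> R)
    (lg : K -> K) : Prop :=
  IwasawaLog {
    ilogM : forall x y, x != 0 -> y != 0 -> lg (x * y) = lg x + lg y;
    ilog_p : lg p%:R = 0;
    ilog_series : forall x, v x < 1 ->
      vcvg v (fun N => \sum_(n < N) (-1) ^+ n * x ^+ n.+1 / n.+1%:R)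
             (lg (1 + x)) }.

(* Diamond's G_p and its derivative psi_p; meaningful off Z_p only *)
Definition log_gamma (R : realType) (K : fieldType) (p : nat) (v : K -> R)
    (lg : K -> K) (x : K) : K :=
  vlim v (fun k => (p%:R ^- k) *
    \sum_(n < p ^ k) ((x + n%:R) * lg (x + n%:R) - (x + n%:R))).

Definition psi (R : realType) (K : fieldType) (p : nat) (v : K -> R)
    (lg : K -> K) : K -> K :=
  vderiv v (log_gamma p v lg).

(* Generalized Bernoulli numbers B_(n, chi), for chi of modulus f:
     sum_(1 <= a <= f) chi(a) t e^(a t) / (e^(f t) - 1)
       = sum_n B_(n, chi) t^n / n!.
   gbern solves this recursively for B_(n, chi); see gbern_genfun. *)
Fixpoint gbern_seq (K : fieldType) (f : nat) (chi : int -> K) (n : nat) :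
    seq K :=
  if n is m.+1 then
    let s := gbern_seq f chi m in
    rcons s ((m.+1%:R * f%:R)^-1 *
      (m.+1%:R * (\sum_(1 <= a < f.+1) chi a%:Z * a%:R ^+ m)
       - \sum_(k < m) 'C(m.+1, k)%:R * f%:R ^+ (m.+1 - k) * s`_k))
  else [::].

Definition gbern (K : fieldType) (f : nat) (chi : int -> K) (n : nat) : K :=
  (gbern_seq f chi n.+1)`_n.

(* t e^t / (e^t - 1) is the case of the trivial character: B_1 = 1/2 *)
Definition bern (K : fieldType) (n : nat) : K := gbern 1 (fun=> 1) n.

Lemma size_gbern_seq (K : fieldType) (f : nat) (chi : int -> K) (n : nat) :
  size (gbern_seq f chi n) = n.
Proof. by elim: n => //= n IHn; rewrite size_rcons IHn. Qed.

Lemma nth_gbern_seq (K : fieldType) (f : nat) (chi : int -> K) (n k : nat) :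
  (k < n)%N -> (gbern_seq f chi n)`_k = gbern f chi k.
Proof.
elim: n => // n IHn; rewrite ltnS leq_eqVlt => /predU1P[-> // | ltkn].
by rewrite /= nth_rcons size_gbern_seq ltkn IHn.
Qed.

Lemma gbern_rec (K : fieldType) (f : nat) (chi : int -> K) (n : nat) :
  [pchar K] =i pred0 -> (0 < f)%N ->
  \sum_(k < n.+1) 'C(n.+1, k)%:R * f%:R ^+ (n.+1 - k) * gbern f chi k
    = n.+1%:R * \sum_(1 <= a < f.+1) chi a%:Z * a%:R ^+ n.
Proof.
move=> /pcharf0P ch0 f_gt0; rewrite big_ord_recr /= subSnn expr1 binSn.
rewrite {2}/gbern /= nth_rcons size_gbern_seq ltnn eqxx mulVKf.
  under [in X in _ - X]eq_bigr => k _ do rewrite nth_gbern_seq //.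
  by rewrite addrC subrK.
by rewrite mulf_neq0 // ch0 // -lt0n.
Qed.

(* Coefficient of t^n in
     (sum_k B_(k, chi) t^k / k!) (e^(f t) - 1) = sum_a chi(a) t e^(a t) *)
Lemma gbern_genfun (K : fieldType) (f : nat) (chi : int -> K) (n : nat) :
  [pchar K] =i pred0 -> (0 < f)%N ->
  \sum_(k < n.+1) gbern f chi k / k`!%:R *
      (if (n - k)%N is 0%N then 0 else f%:R ^+ (n - k) / (n - k)`!%:R)
    = if n is m.+1 then \sum_(1 <= a < f.+1) chi a%:Z * (a%:R ^+ m / m`!%:R)
      else 0.
Proof.
move=> ch0 f_gt0; have /pcharf0P chE := ch0.
have nzf m : m`!%:R != 0 :> K by rewrite chE -lt0n fact_gt0.
case: n => [|n]; first by rewrite big_ord1 subnn mulr0.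
rewrite big_ord_recr /= subnn mulr0 addr0.
have EC (k : 'I_n.+1) : gbern f chi k / k`!%:R *
    (if (n.+1 - k)%N is 0%N then 0
     else f%:R ^+ (n.+1 - k) / (n.+1 - k)`!%:R)
  = n.+1`!%:R^-1 * ('C(n.+1, k)%:R * f%:R ^+ (n.+1 - k) * gbern f chi k).
  rewrite -(bin_fact (ltnW (ltn_ord k))) !natrM.
  have x0 := nzf k; have y0 := nzf (n.+1 - k)%N.
  have c0 : 'C(n.+1, k)%:R != 0 :> K.
    by rewrite chE -lt0n bin_gt0 ltnW.
  have [d dE] : exists d, (n.+1 - k)%N = d.+1.
    by exists (n - k)%N; rewrite subSn // -ltnS.
  rewrite dE in y0 *; move: c0 x0 y0 (f%:R ^+ d.+1) (gbern f chi k).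
  move: ('C(n.+1, k)%:R) (k`!%:R) (d.+1`!%:R) => c x y c0 x0 y0 F B.
  by field; rewrite c0 x0 y0.
rewrite (eq_bigr _ (fun k _ => EC k)) -mulr_sumr gbern_rec //.
rewrite factS natrM invfM -mulrA mulrCA mulKf ?chE //.
  by rewrite mulr_sumr; apply: eq_bigr => a _; rewrite mulrC mulrA.
Qed.

Definition dirichlet_character (K : fieldType) (N : nat) (chi : int -> K) :
    Prop :=
  [/\ (0 < N)%N,
      forall a, chi (a + N%:Z) = chi a,
      forall a b, chi (a * b) = chi a * chi b &
      forall a, chi a != 0 <-> coprimez a N%:Z].

Definition primitive_character (K : fieldType) (f : nat) (chi : int -> K) :
    Prop :=
  dirichlet_character f chi /\
  forall d : nat, (d %| f)%N -> (d < f)%N ->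
    exists a : int, [/\ coprimez a f%:Z, (a = 1 %[mod d%:Z])%Z & chi a != 1].

Definition teichmuller (R : realType) (K : fieldType) (p : nat) (v : K -> R)
    (x : K) : K :=
  if v x == 1 then
    xget 0 [set z | (exists2 n : nat, coprime n p & n.-primitive_root z)
                    /\ v (x - z) < 1]
  else 0.

(* The power omega^k as a Dirichlet character modulo p, for k : int; the test
   is needed because 0 ^ 0 = 1. *)
Definition omega_pow (R : realType) (K : fieldType) (p : nat) (v : K -> R)
    (k : int) (a : int) : K :=
  if (p%:Z %| a)%Z then 0 else teichmuller p v a%:~R ^ k.

(* L is the function s |-> L_p(s, chi) on Z_p (on Z_p \ {1} if chi is
   trivial): the continuous function with the prescribed values at s = 1 - n.
   As 1 - n ranges over a dense subset of Z_p, these properties determine L.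
   In the formula, chi omega^(-n) stands for the primitive character xi that
   agrees with the product of chi and omega^(-n) wherever the latter is nonzero;
   so chi need not be primitive, and L depends only on the primitive character
   attached to chi. *)
Record kubota_leopoldt (R : realType) (K : fieldType) (p : nat) (v : K -> R)
    (chi : int -> K) (L : K -> K) : Prop :=
  KubotaLeopoldt {
    KL_continuous : forall s, Zp_in v s ->
      s != 1 \/ (exists a, chi a != 0 /\ chi a != 1) ->
      forall e : R, 0 < e -> exists2 r : R, 0 < r &
        forall t, Zp_in v t -> v (t - s) < r -> v (L t - L s) < e;
    KL_interpolation : forall (n f : nat) (xi : int -> K),
      (0 < n)%N -> primitive_character f xi ->
      (forall a, chi a * omega_pow p v (- n%:Z) a != 0 ->
         xi a = chi a * omega_pow p v (- n%:Z) a) ->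
      L (1 - n%:R) =
        - ((1 - xi p%:Z * p%:R ^+ n.-1) * gbern f xi n / n%:R) }.

(* x^(j-3) psi_p'(1/x), with the value of its power series
   sum_(n >= j-2) B_(n-j+2) x^n at x = 0 *)
Definition integrand (R : realType) (K : fieldType) (p : nat) (v : K -> R)
    (lg : K -> K) (j : nat) (x : K) : K :=
  if x == 0 then
    vlim v (fun N => \sum_(j - 2 <= n < N) bern K (n - (j - 2)) * 0 ^+ n)
  else x ^ (j%:Z - 3) * vderiv v (psi p v lg) x^-1.

Definition delta (R : realType) (K : fieldType) (p : nat) (v : K -> R)
    (i : nat) : K :=
  \sum_(z \in [set z : K | z ^+ p.-1 = 1])
    z ^+ i.+1 / (1 - teichmuller p v (1 - z)).

(* Main.v *)
(* Write int F(u) du for the Volkenborn integral, the limit of p^(-m) times the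
   sum of F over 0 <= u < p^m. For v x < 1 the integrand at x is
   int x^(j-2) / (1 + x u) du. With q = p^k, summing this over x = 1 - z, z^q = 1,
   gives a rational function of u: the k-th arc sum is, after the reflection
   u = - b,
     - int b^(q-j+1) / (b^q - (b-1)^q) db.
   As k grows, b^q tends to the Teichmuller representative w(b), so the integral
   over the arc is - int w(b) b^(1-j) / (w(b) - w(b-1)) db. On the other side,
   interpolating at n = p^k (p-1) + 1 - j gives
     (1 - j) L_p(j, w^(i-j+2)) = - int w(b)^(i+1) b^(1-j) db,
   and the sum of delta_i w(b)^(i+1) over i is (p-1) w(b) / (w(b) - w(b-1)) by
   orthogonality.
   The interchanges of limits are uniform estimates: all functions involved have
   first and second differences bounded by |h| and |h| |g|. *)
Require Import Defs.
From mathcomp Require Import all_boot all_order all_algebra.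
From mathcomp Require Import boolp classical_sets fsbigop reals topology.
From mathcomp Require Import normedtype sequences.
From mathcomp Require Import ring lra zify.
Set Implicit Arguments.
Unset Strict Implicit.
Unset Printing Implicit Defensive.
Import Order.TTheory GRing.Theory Num.Theory.
Import numFieldNormedType.Exports.
Local Open Scope ring_scope.

(** The obstacle is the interchange of the limit in k with the Volkenborn integral: because of the
    factor p^(-m), uniform convergence of integrands does not give convergence of integrals. The
    remedy is the class [smooth c], whose bound on second differences gives every integral the same
    rate c p^2 p^(-m). The kernels on both sides belong to it with c = 1 for every k, since b^(p^k)
    - (b-1)^(p^k) is congruent to 1 modulo p and hence has absolute value 1. The same class allows
    differentiation under the integral, once from log gamma to psi and once more from psi to the
    integral of 1/(y + u). The reflection matches the two sides: generalized Bernoulli numbers sum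
    over 1 <= a <= f, so L-values are integrals in b = a + 1, whereas the arc sums first appear in u
    = - b. For odd p all signs then cancel. Exponents of w run over 1, ..., p-1 and not 0, ..., p-2,
    so that w(b)^e vanishes at multiples of p. At e = p-1 the primitive character is trivial, and
    there the Euler factor has to be accounted for. *)

Section Nonarchimedean.
Context (R : realType) (K : fieldType) (p : nat) (v : K -> R).
Hypotheses (p_pr : prime p) (vP : pabs p v).

Let p_gt0 : (0 : R) < p%:R. Proof. by rewrite ltr0n prime_gt0. Qed.

Let pVX_ge0 n : (0 : R) <= p%:R ^- n.
Proof. by rewrite invr_ge0 exprn_ge0 // ltW. Qed.

(** * Elementary properties of the absolute value *)

Lemma abs_ge0 x : 0 <= v x. Proof. exact: (pabs_ge0 vP). Qed.

Lemma absM x y : v (x * y) = v x * v y. Proof. exact: (pabsM vP). Qed.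

Lemma abs0 : v 0 = 0. Proof. exact/(pabs_eq0 vP). Qed.

Lemma abs_eq0 x : (v x == 0) = (x == 0).
Proof. by apply/eqP/eqP => /(pabs_eq0 vP). Qed.

Lemma abs_gt0 x : (0 < v x) = (x != 0).
Proof. by rewrite lt0r abs_ge0 andbT abs_eq0. Qed.

Lemma abs1 : v 1 = 1.
Proof.
have v10 : v 1 != 0 by rewrite abs_eq0 oner_eq0.
by apply: (mulfI v10); rewrite -absM !mulr1.
Qed.

Lemma absN x : v (- x) = v x.
Proof.
have vN1 : v (-1) = 1.
  apply/eqP; rewrite -(@eqrXn2 _ 2) ?abs_ge0 ?ler01 //.
  by rewrite expr1n expr2 -absM mulrNN mulr1 abs1.
by rewrite -mulN1r absM vN1 mul1r.
Qed.

Lemma absX x n : v (x ^+ n) = v x ^+ n.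
Proof. by elim: n => [|n IHn]; rewrite ?abs1 // !exprS absM IHn. Qed.

Lemma absV x : v x^-1 = (v x)^-1.
Proof.
have [->|x0] := eqVneq x 0; first by rewrite invr0 abs0 invr0.
have vx0 : v x != 0 by rewrite abs_eq0.
by apply: (mulfI vx0); rewrite -absM !mulfV // abs1.
Qed.

Lemma absD c x y : v x <= c -> v y <= c -> v (x + y) <= c.
Proof.
by move=> xc yc; apply: le_trans (pabsD vP x y) _; rewrite ge_max xc.
Qed.

Lemma absB c x y : v x <= c -> v y <= c -> v (x - y) <= c.
Proof. by move=> xc yc; apply: absD; rewrite ?absN. Qed.

Lemma absBC x y : v (x - y) = v (y - x).
Proof. by rewrite -opprB absN. Qed.

Lemma abs_triangle z c x y : v (x - z) <= c -> v (z - y) <= c -> v (x - y) <= c.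
Proof. by move=> xz zy; rewrite -(subrKA z); apply: absD. Qed.

Lemma absD_lt e x y : v x < e -> v y < e -> v (x + y) < e.
Proof.
by move=> xe ye; apply: le_lt_trans (pabsD vP x y) _; rewrite gt_max xe.
Qed.

Lemma absB_lt e x y : v x < e -> v y < e -> v (x - y) < e.
Proof. by move=> xe ye; apply: absD_lt; rewrite ?absN. Qed.

Lemma abs_sum (I : Type) (r : seq I) (P : pred I) (F : I -> K) c :
  0 <= c -> (forall i, P i -> v (F i) <= c) -> v (\sum_(i <- r | P i) F i) <= c.
Proof.
move=> c0 Fc; apply: (big_ind (fun x => v x <= c)) => //; first by rewrite abs0.
by move=> x y; apply: absD.
Qed.

Lemma absD_eq x y : v y < v x -> v (x + y) = v x.
Proof.
move=> yx; apply/eqP; rewrite eq_le absD ?(ltW yx) //=.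
rewrite leNgt; apply/negP => xyx.
by have := absB_lt xyx yx; rewrite addrK ltxx.
Qed.

Lemma abs_nat n : v n%:R <= 1.
Proof.
elim: n => [|n IHn]; first by rewrite abs0 ler01.
by rewrite -natr1; apply: absD; rewrite ?abs1.
Qed.

Lemma abs_int (a : int) : v a%:~R <= 1.
Proof. by case: a => n; rewrite ?NegzE ?mulrNz ?absN abs_nat. Qed.

Lemma abs_pX n : v (p%:R ^+ n) = p%:R ^- n.
Proof. by rewrite absX (pabs_p vP) exprVn. Qed.

Lemma invp_lt1 : (p%:R : R)^-1 < 1.
Proof. by rewrite invf_lt1 // ltr1n prime_gt1. Qed.

Lemma pX_neq0 n : (p%:R ^+ n : K) != 0.
Proof.
by rewrite -abs_gt0 abs_pX invr_gt0 exprn_gt0.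
Qed.

(** In a Bezout relation [u n - w p = 1] the multiple of [p] has absolute value below 1, so the
    multiple of [n] cannot. *)
Lemma abs_nat_coprime n : coprime p n -> v n%:R = 1.
Proof.
move=> pn; have n0 : (0 < n)%N.
  by case: n pn => //; rewrite /coprime gcdn0 => /eqP p1; move: p_pr; rewrite p1.
have [u w E _] := egcdnP p n0; rewrite gcdnC (eqP pn) in E.
apply/eqP; rewrite eq_le abs_nat /= leNgt; apply/negP => vn.
have : v (u%:R * n%:R - w%:R * p%:R) < 1.
  apply: absB_lt; rewrite absM.
    by apply: le_lt_trans vn; rewrite ler_piMl ?abs_ge0 ?abs_nat.
  rewrite (pabs_p vP); apply: le_lt_trans invp_lt1.
  by rewrite ler_piMl ?abs_nat // invr_ge0 ltW.
by rewrite -!natrM E natrD addrAC subrr add0r abs1 ltxx.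
Qed.

(** The p-part of [n] is at most [n]. This controls the denominators of the logarithm series. *)
Lemma abs_nat_ge n : (0 < n)%N -> n%:R^-1 <= v n%:R.
Proof.
move=> n0; have [m pm nE] := pfactor_coprime p_pr n0.
have m0 : (0 < m)%N by move: n0; rewrite nE muln_gt0 => /andP[].
rewrite nE [in leRHS]natrM absM abs_nat_coprime // mul1r natrX abs_pX -natrX.
by rewrite lef_pV2 ?posrE ?ltr0n ?muln_gt0 ?m0 ?expn_gt0 ?prime_gt0 // ler_nat leq_pmull.
Qed.

Lemma abs_nat_neq0 n : (0 < n)%N -> n%:R != 0 :> K.
Proof.
move=> n0; rewrite -abs_gt0; apply: lt_le_trans (abs_nat_ge n0).
by rewrite invr_gt0 ltr0n.
Qed.

Lemma abs_pchar0 : [pchar K] =i pred0.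
Proof.
apply/pcharf0P; case=> [|n]; first by rewrite !eqxx.
by rewrite (negPf (abs_nat_neq0 (ltn0Sn n))).
Qed.

Lemma abs_int_le_invp (a : int) : (p%:Z %| a)%Z -> v a%:~R <= p%:R^-1.
Proof.
case/dvdzP=> b ->; rewrite rmorphM /= absM (pabs_p vP).
by rewrite ler_piMl ?abs_int // invr_ge0 ltW.
Qed.

Lemma abs_int_unit (a : int) : ~~ (p%:Z %| a)%Z -> v a%:~R = 1.
Proof.
move=> pa; have -> : v a%:~R = v `|a|%N%:R.
  by case: a {pa} => n //; rewrite NegzE mulrNz absN abszN absz_nat.
by apply: abs_nat_coprime; rewrite prime_coprime.
Qed.

Lemma invpX_small (c e : R) : 0 < e ->
  exists N, forall n, (N <= n)%N -> c * p%:R ^- n < e.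
Proof.
move=> e0; have ce0 : 0 <= `|c| / e by rewrite divr_ge0 // ltW.
have N_gt := archi_boundP ce0; set N := Num.bound _ in N_gt.
exists N => n Nn; apply: le_lt_trans (ler_wpM2r _ (ler_norm c)) _.
  by rewrite invr_ge0 exprn_ge0 // ltW.
rewrite ltr_pdivrMr ?exprn_gt0 // mulrC -ltr_pdivrMr //.
apply: lt_trans N_gt _; rewrite -natrX ltr_nat.
apply: leq_ltn_trans Nn _; apply: ltn_expl.
exact: prime_gt1.
Qed.

Let pK0 : (p%:R : K) != 0.
Proof. by rewrite -[p%:R]expr1 pX_neq0. Qed.

(** * Limits *)

Section Convergence.
Implicit Types (u w : nat -> K) (l m : K).

Lemma vcvgP u l : vcvg v u l <->
  forall e, 0 < e -> exists N, forall n, (N <= n)%N -> v (u n - l) < e.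
Proof.
split=> [/cvgrPdist_lt ul e e0|ul].
  have [N _ NP] := ul _ e0; exists N => n Nn; have := NP n Nn.
  by rewrite sub0r normrN ger0_norm // abs_ge0.
apply/cvgrPdist_lt => e e0; have [N NP] := ul _ e0; exists N => // n /= Nn.
by rewrite sub0r normrN ger0_norm ?abs_ge0 // NP.
Qed.

Lemma vcvg_unique u l m : vcvg v u l -> vcvg v u m -> l = m.
Proof.
move=> /vcvgP ul /vcvgP um; apply/eqP; rewrite -subr_eq0 -abs_eq0.
rewrite eq_le abs_ge0 andbT leNgt; apply/negP => lm.
have [N NP] := ul _ lm; have [M MP] := um _ lm.
have := absB_lt (MP (maxn N M) (leq_maxr _ _)) (NP (maxn N M) (leq_maxl _ _)).
by rewrite opprB addrC subrKA ltxx.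
Qed.

Lemma vlimE u l : vcvg v u l -> vlim v u = l.
Proof. by move=> ul; apply: xget_unique => // m um; exact: vcvg_unique um ul. Qed.

Lemma vcvg_eventually N u w l :
  (forall n, (N <= n)%N -> u n = w n) -> vcvg v u l -> vcvg v w l.
Proof.
move=> uw /vcvgP ul; apply/vcvgP => e /ul[M MP]; exists (maxn N M) => n.
by rewrite geq_max => /andP[Nn Mn]; rewrite -uw // MP.
Qed.

Lemma vcvg_ext u w l : u =1 w -> vcvg v u l -> vcvg v w l.
Proof. by move=> uw; apply: (@vcvg_eventually 0) => n _. Qed.

Lemma vcvg_shift N u l : vcvg v (fun n => u (n + N)%N) l <-> vcvg v u l.
Proof.
split=> /vcvgP ul; apply/vcvgP => e /ul[M MP].
  exists (M + N)%N => n Mn; rewrite -(subnK (leq_trans (leq_addl M N) Mn)).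
  by apply: MP; lia.
by exists M => n Mn; apply: MP; apply: leq_trans Mn (leq_addr _ _).
Qed.

Lemma vcvg_rate u l (c : R) :
  (forall n, v (u n - l) <= c * p%:R ^- n) -> vcvg v u l.
Proof.
move=> ul; apply/vcvgP => e /(invpX_small c)[N NP]; exists N => n Nn.
exact: le_lt_trans (ul n) (NP n Nn).
Qed.

Lemma vcvg_cst l : vcvg v (fun=> l) l.
Proof. by apply/vcvgP => e e0; exists 0%N => n _; rewrite subrr abs0. Qed.

Lemma vcvg_le u l c : (forall n, v (u n) <= c) -> vcvg v u l -> v l <= c.
Proof.
move=> uc /vcvgP ul; rewrite leNgt; apply/negP => cl.
have l0 : 0 < v l by apply: le_lt_trans cl; apply: le_trans (uc 0%N); exact: abs_ge0.
have [N NP] := ul _ l0; have := NP N (leqnn N).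
by rewrite absBC absD_eq ?absN ?ltxx // (le_lt_trans (uc N)).
Qed.

Lemma vcvgD u w l m : vcvg v u l -> vcvg v w m ->
  vcvg v (fun n => u n + w n) (l + m).
Proof.
move=> /vcvgP ul /vcvgP wm; apply/vcvgP => e e0.
have [N NP] := ul _ e0; have [M MP] := wm _ e0.
exists (maxn N M) => n; rewrite geq_max => /andP[Nn Mn].
by rewrite opprD addrACA; apply: absD_lt; [exact: NP|exact: MP].
Qed.

Lemma vcvgM u w l m : vcvg v u l -> vcvg v w m ->
  vcvg v (fun n => u n * w n) (l * m).
Proof.
move=> /vcvgP ul /vcvgP wm; apply/vcvgP => e e0.
have c0 : 0 < v l + v m + 1 by rewrite ltr_wpDl ?addr_ge0 ?abs_ge0.
have [N NP] := ul _ (divr_gt0 e0 c0); have [L LP] := ul _ ltr01.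
have [M MP] := wm _ (divr_gt0 e0 c0).
exists (maxn N (maxn L M)) => n; rewrite !geq_max => /and3P[Nn Ln Mn].
have -> : u n * w n - l * m = (u n - l) * m + u n * (w n - m) by ring.
have un : v (u n) <= v l + v m + 1.
  rewrite -(subrK l (u n)); apply: absD.
    by rewrite (le_trans (ltW (LP n Ln))) // ler_wpDl ?addr_ge0 ?abs_ge0.
  by rewrite -addrA lerDl addr_ge0 ?abs_ge0.
apply: absD_lt; rewrite absM.
  have [->|m0] := eqVneq m 0; first by rewrite abs0 mulr0.
  have vm : 0 < v m by rewrite abs_gt0.
  rewrite -ltr_pdivlMr //; apply: lt_le_trans (NP n Nn) _.
  rewrite ler_pM2l // lef_pV2 ?posrE // addrAC lerDr addr_ge0 //.
  exact: abs_ge0.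
apply: le_lt_trans (ler_wpM2r (abs_ge0 _) un) _.
by rewrite mulrC -ltr_pdivlMr // MP.
Qed.

Lemma vcvgZ u l k : vcvg v u l -> vcvg v (fun n => k * u n) (k * l).
Proof. by apply: vcvgM; exact: vcvg_cst. Qed.

Lemma vcvgN u l : vcvg v u l -> vcvg v (fun n => - u n) (- l).
Proof.
move=> ul; rewrite -mulN1r; apply: vcvg_ext (vcvgZ (-1) ul) => n.
by rewrite mulN1r.
Qed.

Lemma vcvgB u w l m : vcvg v u l -> vcvg v w m ->
  vcvg v (fun n => u n - w n) (l - m).
Proof. by move=> ul wm; apply: vcvgD => //; exact: vcvgN. Qed.

Lemma vcvgX u l k : vcvg v u l -> vcvg v (fun n => u n ^+ k) (l ^+ k).
Proof.
move=> ul; elim: k => [|k IHk]; first exact: vcvg_cst.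
rewrite exprS; apply: vcvg_ext (vcvgM ul IHk) => n.
by rewrite exprS.
Qed.

Lemma vcvgV u l : l != 0 -> vcvg v u l -> vcvg v (fun n => (u n)^-1) l^-1.
Proof.
move=> l0 /vcvgP ul; have vl : 0 < v l by rewrite abs_gt0.
apply/vcvgP => e e0; have [N NP] := ul _ vl.
have e1 : 0 < e * (v l * v l) by rewrite !mulr_gt0.
have [M MP] := ul _ e1; exists (maxn N M) => n.
rewrite geq_max => /andP[/NP Nn /MP Mn].
have vu : v (u n) = v l by rewrite -(subrK l (u n)) addrC absD_eq.
have u0 : u n != 0 by rewrite -abs_gt0 vu.
have -> : (u n)^-1 - l^-1 = (l - u n) / (l * u n) by field; apply/andP.
by rewrite absM absV absM vu ltr_pdivrMr ?mulr_gt0 // absBC.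
Qed.

Lemma vcvg_sum (I : Type) (r : seq I) (P : pred I) (F : nat -> I -> K)
    (G : I -> K) : (forall i, P i -> vcvg v (F^~ i) (G i)) ->
  vcvg v (fun n => \sum_(i <- r | P i) F n i) (\sum_(i <- r | P i) G i).
Proof.
move=> FG; elim: r => [|i r IHr].
  rewrite big_nil; apply: vcvg_ext (vcvg_cst 0) => n; by rewrite big_nil.
rewrite big_cons; case: ifPn => Pi; last first.
  by apply: vcvg_ext IHr => n; rewrite big_cons (negPf Pi).
by apply: vcvg_ext (vcvgD (FG i Pi) IHr) => n; rewrite big_cons Pi.
Qed.

End Convergence.

(** * Smooth functions and Volkenborn integrals *)

Section Smooth.
Implicit Types (F G : int -> K) (c d : R).

(* The p-adic C^2 condition, in a form without derivatives; it is stable under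
   pointwise limits, and it suffices for Volkenborn integrability with a rate
   that depends on c only. *)
Record smooth c F : Prop := Smooth {
  smooth_bound : forall a, v (F a) <= c;
  smooth_lip : forall a h : int, v (F (a + h) - F a) <= c * v h%:~R;
  smooth_lip2 : forall a h g : int,
    v (F (a + h + g) - F (a + h) - (F (a + g) - F a))
      <= c * (v h%:~R * v g%:~R) }.

Lemma smooth_ge0 c F : smooth c F -> 0 <= c.
Proof. by move=> /smooth_bound/(_ 0); apply: le_trans; exact: abs_ge0. Qed.

Lemma smooth_le c d F : c <= d -> smooth c F -> smooth d F.
Proof.
move=> cd [F0 F1 F2]; split=> [a|a h|a h g].
- exact: le_trans (F0 a) cd.
- by apply: le_trans (F1 a h) _; rewrite ler_wpM2r ?abs_ge0.
- by apply: le_trans (F2 a h g) _; rewrite ler_wpM2r ?mulr_ge0 ?abs_ge0.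
Qed.

Lemma smooth_ext c F G : F =1 G -> smooth c F -> smooth c G.
Proof. by move=> /funext ->. Qed.

Lemma smooth_cst c k : v k <= c -> smooth c (fun=> k).
Proof.
move=> kc; have c0 : 0 <= c by apply: le_trans kc; exact: abs_ge0.
by split=> // *; rewrite ?subrr abs0 !mulr_ge0 ?abs_ge0.
Qed.

Lemma smooth_int : smooth 1 (fun a => a%:~R).
Proof.
split=> [a|a h|a h g]; first exact: abs_int.
- by rewrite intrD addrAC subrr add0r mul1r.
- rewrite [X in v X](_ : _ = 0) ?abs0 ?mul1r ?mulr_ge0 ?abs_ge0 //.
  by rewrite !intrD; ring.
Qed.

Lemma smooth_shift c F b : smooth c F -> smooth c (fun a => F (a + b)).
Proof.
move=> [F0 F1 F2]; split=> [a|a h|a h g]; first exact: F0.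
- by rewrite addrAC; exact: F1.
- by rewrite !(addrAC _ _ b); exact: F2.
Qed.

Lemma smoothD c F G : smooth c F -> smooth c G -> smooth c (fun a => F a + G a).
Proof.
move=> [F0 F1 F2] [G0 G1 G2]; split=> [a|a h|a h g]; first exact: absD.
- by rewrite opprD addrACA; apply: absD.
- rewrite [X in v X](_ : _ = (F (a + h + g) - F (a + h) - (F (a + g) - F a)) +
    (G (a + h + g) - G (a + h) - (G (a + g) - G a))); last by ring.
  exact: absD.
Qed.

Lemma smoothM c d F G : smooth c F -> smooth d G ->
  smooth (c * d) (fun a => F a * G a).
Proof.
move=> sF sG; have c0 := smooth_ge0 sF; have d0 := smooth_ge0 sG.
case: sF sG => [F0 F1 F2] [G0 G1 G2].
have ge0 := abs_ge0; split=> [a|a h|a h g].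
- by rewrite absM ler_pM.
- rewrite (_ : _ - _ = (F (a + h) - F a) * G (a + h) + F a * (G (a + h) - G a));
    last by ring.
  apply: absD; rewrite absM; first by rewrite mulrAC ler_pM.
  by rewrite -mulrA ler_pM.
- have G1' := G1 (a + g) h; rewrite addrAC in G1'.
  (* Leibniz rule for second differences. Each mixed term has one first difference in each factor,
     so its bound again contains [v h * v g]; the ultrametric inequality keeps the constant at
     [c * d]. *)
  rewrite [X in v X](_ : _ =
    (F (a + h + g) - F (a + h) - (F (a + g) - F a)) * G (a + h + g) +
    (F (a + h) - F a) * (G (a + h + g) - G (a + h)) +
    (F (a + g) - F a) * (G (a + h + g) - G (a + g)) +
    F a * (G (a + h + g) - G (a + h) - (G (a + g) - G a))); last by ring.
  apply: absD; first apply: absD; first apply: absD; rewrite absM.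
  + by rewrite mulrAC ler_pM.
  + by rewrite mulrACA ler_pM.
  + by rewrite [v h%:~R * _]mulrC mulrACA ler_pM.
  + by rewrite -mulrA ler_pM.
Qed.

Lemma smoothZ c F k : smooth c F -> smooth (v k * c) (fun a => k * F a).
Proof. by apply: smoothM; exact: smooth_cst. Qed.

Lemma smoothN c F : smooth c F -> smooth c (fun a => - F a).
Proof.
move=> sF; have := smoothZ (-1) sF; rewrite absN abs1 mul1r.
by apply: smooth_ext => a; rewrite mulN1r.
Qed.

Lemma smoothB c F G : smooth c F -> smooth c G -> smooth c (fun a => F a - G a).
Proof. by move=> sF sG; apply: smoothD => //; exact: smoothN. Qed.

Lemma smoothX c F n : smooth c F -> smooth (c ^+ n) (fun a => F a ^+ n).
Proof.
move=> sF; elim: n => [|n IHn].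
  by apply: smooth_cst; rewrite expr0 abs1.
rewrite exprS; apply: smooth_ext (smoothM sF IHn) => a.
by rewrite exprS.
Qed.

Lemma smooth_sum (I : Type) (r : seq I) (P : pred I) (F : I -> int -> K) c :
  0 <= c -> (forall i, P i -> smooth c (F i)) ->
  smooth c (fun a => \sum_(i <- r | P i) F i a).
Proof.
move=> c0 sF; elim: r => [|i r IHr].
  by apply: (@smooth_ext c (fun=> 0)) => [a|]; rewrite ?big_nil //;
    apply: smooth_cst; rewrite abs0.
case Pi : (P i); last by apply: smooth_ext IHr => a; rewrite big_cons Pi.
by apply: smooth_ext (smoothD (sF i Pi) IHr) => a; rewrite big_cons Pi.
Qed.

Lemma smoothV F : smooth 1 F -> (forall a, v (F a) = 1) ->
  smooth 1 (fun a => (F a)^-1).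
Proof.
move=> [_ F1 F2] Fu; have F0 a : F a != 0 by rewrite -abs_gt0 Fu.
have Fv a : v (F a)^-1 = 1 by rewrite absV Fu invr1.
have V1 a h : v ((F (a + h))^-1 - (F a)^-1) <= v h%:~R.
  rewrite (_ : _ - _ = - ((F (a + h) - F a) / (F (a + h) * F a))).
    by rewrite absN absM absV absM !Fu mulr1 invr1 mulr1 -[v h%:~R]mul1r.
  by field; rewrite !F0.
have ge0 := abs_ge0; split=> [a|a h|a h g]; rewrite ?mul1r ?Fv //.
have F1' := F1 (a + g) h; rewrite addrAC mul1r in F1'.
have F1'' := F1 (a + h) g; rewrite mul1r in F1''.
(* Second difference of 1/F over a common denominator: two products of first differences and one
   second difference of F, all divided by units. *)
rewrite [X in v X](_ : _ = - (
    ((F (a + h))^-1 - (F a)^-1) * (F (a + h + g) - F (a + h)) +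
    ((F (a + g))^-1 - (F a)^-1) * (F (a + h + g) - F (a + g)) +
    (F a)^-1 * (F (a + h + g) - F (a + h) - (F (a + g) - F a))) /
    F (a + h + g)); last by field; rewrite !F0.
rewrite absM Fv mulr1 absN.
apply: absD; first apply: absD; rewrite absM.
- by rewrite ler_pM.
- by rewrite mulrC ler_pM.
- by rewrite Fv mul1r; apply: le_trans (F2 _ _ _) _; rewrite mul1r.
Qed.

Lemma smooth_lim c (F : nat -> int -> K) G :
  (forall n, smooth c (F n)) -> (forall a, vcvg v (F^~ a) (G a)) -> smooth c G.
Proof.
move=> sF FG; split=> [a|a h|a h g].
- by apply: (vcvg_le _ (FG a)) => n; exact: smooth_bound.
- apply: (vcvg_le _ (vcvgB (FG (a + h)) (FG a))) => n; exact: smooth_lip.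
- apply: (vcvg_le _ (vcvgB (vcvgB (FG (a + h + g)) (FG (a + h)))
    (vcvgB (FG (a + g)) (FG a)))) => n; exact: smooth_lip2.
Qed.

End Smooth.

(** * Volkenborn integrals: rate of convergence, limits, reflection *)

Section Volkenborn.
Implicit Types (F G : int -> K) (c d : R).

Definition volk_sum F (m : nat) : K := p%:R ^- m * \sum_(n < p ^ m) F n%:Z.

Definition volkenborn F (l : K) : Prop := vcvg v (volk_sum F) l.

Lemma sum_blocks (V : zmodType) (F : int -> V) (q b : nat) :
  \sum_(n < q * b) F n%:Z = \sum_(i < b) \sum_(n < q) F (n%:Z + (i * q)%:Z).
Proof.
elim: b => [|b IHb]; first by rewrite muln0 !big_ord0.
rewrite big_ord_recr /= -IHb mulnS addnC big_split_ord /=; congr (_ + _).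
by apply: eq_bigr => i _; rewrite -PoszD addnC mulnC.
Qed.

Lemma abs_mul_pX (i m : nat) : v (i * p ^ m)%:Z%:~R <= p%:R ^- m.
Proof.
rewrite -pmulrn natrM absM natrX abs_pX.
by rewrite ler_piMl ?abs_nat // invr_ge0 exprn_ge0 // ltW.
Qed.

(** Induction on [s]: the sum splits into [p] blocks, each within [d p^(-s)] of the first, and [p]
    times the first block gains a factor 1/p. The extra [p] in the bound pays for the comparison of
    blocks. *)
Lemma abs_sum_lip G d s : (forall a, v (G a) <= d) ->
  (forall a h : int, v (G (a + h) - G a) <= d * v h%:~R) ->
  v (\sum_(n < p ^ s) G n%:Z) <= d * p%:R * p%:R ^- s.
Proof.
move=> G0 G1; have d0 : 0 <= d by apply: le_trans (G0 0); exact: abs_ge0.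
elim: s => [|s IHs].
  rewrite big_ord_recl big_ord0 addr0 invr1 mulr1.
  by apply: le_trans (G0 _) _; rewrite ler_peMr // ler1n prime_gt0.
rewrite expnSr sum_blocks exprS invfM mulrA mulfK ?gt_eqF //.
rewrite -(subrK (p%:R * \sum_(n < p ^ s) G n%:Z) (\sum_(i < p) _)); apply: absD.
  rewrite mulr_natl -[X in _ - _ *+ X]card_ord -sumr_const -sumrB.
  apply: abs_sum => [|i _]; first by rewrite mulr_ge0.
  rewrite -sumrB.
  apply: abs_sum => [|n _]; first by rewrite mulr_ge0.
  by apply: le_trans (G1 _ _) _; rewrite ler_wpM2l ?abs_mul_pX.
rewrite absM (pabs_p vP) mulrC; apply: le_trans (ler_wpM2r _ IHs) _.
  by rewrite invr_ge0 ltW.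
by rewrite mulrAC mulfK ?gt_eqF.
Qed.

(** The increments of F by multiples of p^m have values and Lipschitz constant bounded by c p^(-m),
    so by [abs_sum_lip] their sum gains p^(-m) twice, against one loss of p^(m+1). A Lipschitz bound
    on F alone would only show that the steps are bounded. *)
Lemma volk_sum_step c F m : smooth c F ->
  v (volk_sum F m.+1 - volk_sum F m) <= c * p%:R ^+ 2 * p%:R ^- m.
Proof.
move=> sF; have c0 := smooth_ge0 sF.
rewrite (_ : _ - _ = p%:R ^- m.+1 *
    \sum_(i < p) \sum_(n < p ^ m) (F (n%:Z + (i * p ^ m)%:Z) - F n%:Z)).
  rewrite absM absV abs_pX invrK.
  have H : v (\sum_(i < p) \sum_(n < p ^ m)
      (F (n%:Z + (i * p ^ m)%:Z) - F n%:Z)) <= c * p%:R ^- m * p%:R * p%:R ^- m.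
    apply: abs_sum => [|i _]; first by rewrite !mulr_ge0.
    have vq := abs_mul_pX i m.
    apply: (@abs_sum_lip (fun a => F (a + (i * p ^ m)%:Z) - F a)) => [a|a h].
      by apply: le_trans (smooth_lip sF _ _) _; rewrite ler_wpM2l.
    have := smooth_lip2 sF a (i * p ^ m)%:Z h.
    rewrite (_ : _ - _ = F (a + h + (i * p ^ m)%:Z) - F (a + h) -
      (F (a + (i * p ^ m)%:Z) - F a)); last by rewrite (addrAC a); ring.
    move=> H; apply: le_trans H _; rewrite mulrA ler_wpM2r ?abs_ge0 //.
    by rewrite ler_wpM2l.
  apply: le_trans (ler_wpM2l _ H) _; first by rewrite exprn_ge0 // ltW.
  rewrite le_eqVlt; apply/orP; left; apply/eqP; rewrite exprS.
  by field; rewrite expf_neq0 ?gt_eqF.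
rewrite /volk_sum expnSr sum_blocks.
under [in RHS]eq_bigr => i _ do rewrite sumrB.
rewrite sumrB sumr_const card_ord mulrBr exprSr.
by congr (_ - _); field; rewrite pK0 pX_neq0.
Qed.

Lemma volk_sum_rate c F l : smooth c F -> volkenborn F l ->
  forall m, v (volk_sum F m - l) <= c * p%:R ^+ 2 * p%:R ^- m.
Proof.
move=> sF Fl m; have c0 := smooth_ge0 sF.
have Sm k : v (volk_sum F m - volk_sum F (k + m)) <= c * p%:R ^+ 2 * p%:R ^- m.
  elim: k => [|k IHk]; first by rewrite subrr abs0 !mulr_ge0 ?exprn_ge0.
  apply: (abs_triangle IHk); rewrite absBC addSn.
  apply: le_trans (volk_sum_step _ sF) _.
  rewrite ler_wpM2l ?mulr_ge0 ?exprn_ge0 // lef_pV2 ?posrE ?exprn_gt0 //.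
  by rewrite ler_weXn2l ?leq_addl // ler1n prime_gt0.
apply: vcvg_le Sm (vcvgB (vcvg_cst _) _).
by have [_] := vcvg_shift m (volk_sum F) l; apply.
Qed.

Lemma volkenborn_bound c F l : smooth c F -> volkenborn F l ->
  v l <= c * p%:R ^+ 2.
Proof.
move=> sF Fl; have c0 := smooth_ge0 sF; rewrite -(subKr (F 0) l).
apply: absB.
  apply: le_trans (smooth_bound sF _) _; rewrite ler_peMr // -natrX ler1n.
  by rewrite expn_gt0 prime_gt0.
have := volk_sum_rate sF Fl 0.
by rewrite /volk_sum !expr0 !invr1 mulr1 mul1r big_ord1.
Qed.

Lemma volkenbornZ F l k : volkenborn F l -> volkenborn (fun a => k * F a) (k * l).
Proof.
move=> Fl; apply: vcvg_ext (vcvgZ k Fl) => m.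
by rewrite /volk_sum mulrCA mulr_sumr.
Qed.

Lemma volkenborn_sum (I : Type) (r : seq I) (P : pred I) (F : I -> int -> K)
    (l : I -> K) : (forall i, P i -> volkenborn (F i) (l i)) ->
  volkenborn (fun a => \sum_(i <- r | P i) F i a) (\sum_(i <- r | P i) l i).
Proof.
move=> Fl; apply: vcvg_ext (vcvg_sum r Fl) => m.
by rewrite /volk_sum exchange_big -mulr_sumr.
Qed.

Lemma volkenbornB F G l k : volkenborn F l -> volkenborn G k ->
  volkenborn (fun a => F a - G a) (l - k).
Proof.
move=> Fl Gk; apply: vcvg_ext (vcvgB Fl Gk) => m.
by rewrite /volk_sum -mulrBr -sumrB.
Qed.

Lemma volkenborn_ext F G l : (forall n : nat, F n%:Z = G n%:Z) ->
  volkenborn F l -> volkenborn G l.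
Proof.
by move=> FG; apply: vcvg_ext => m; rewrite /volk_sum; under eq_bigr do rewrite FG.
Qed.

Lemma volkenborn_cst k : volkenborn (fun=> k) k.
Proof.
apply: vcvg_ext (vcvg_cst k) => m; rewrite /volk_sum sumr_const card_ord.
by rewrite -[k *+ _]mulr_natl natrX mulKf ?pX_neq0.
Qed.

(** The common constant [c] lets one [m] approximate all the integrals at once; for this fixed [m]
    the sums are finite and converge termwise. *)
Lemma volkenborn_lim c (F : nat -> int -> K) G (l : nat -> K) k :
  (forall n, smooth c (F n)) -> (forall a, vcvg v (F^~ a) (G a)) ->
  (forall n, volkenborn (F n) (l n)) -> volkenborn G k -> vcvg v l k.
Proof.
move=> sF FG Fl Gk; have sG := smooth_lim sF FG.
apply/vcvgP => e e0; have [m mP] := invpX_small (c * p%:R ^+ 2) e0.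
have /vcvgP/(_ e e0)[N NP] : vcvg v (fun n => volk_sum (F n) m) (volk_sum G m).
  by apply: vcvgZ; apply: vcvg_sum => i _; exact: FG.
exists N => n /NP Nn.
rewrite (_ : l n - k = (l n - volk_sum (F n) m) +
  (volk_sum (F n) m - volk_sum G m) + (volk_sum G m - k)); last by ring.
have me := mP m (leqnn m).
apply: absD_lt; first apply: absD_lt => //.
  by rewrite absBC; apply: le_lt_trans (volk_sum_rate (sF n) (Fl n) m) me.
by apply: le_lt_trans (volk_sum_rate sG Gk m) me.
Qed.

(** Reversing the order of summation replaces [- a - 1] by [a - p^m]. The effect of this translation
    is a sum of increments, again small by [abs_sum_lip]. *)
Lemma volkenborn_reflect c F l : smooth c F -> volkenborn F l ->
  volkenborn (fun a => F (- a - 1)) l.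
Proof.
move=> sF Fl; have c0 := smooth_ge0 sF.
have H : vcvg v (fun m => volk_sum (fun a => F (- a - 1)) m - volk_sum F m) 0.
  apply: (@vcvg_rate _ _ (c * p%:R)) => m.
  rewrite subr0 /volk_sum -mulrBr (reindex_inj rev_ord_inj) /= -sumrB.
  rewrite absM absV abs_pX invrK.
  under eq_bigr => i _.
    have -> : - (p ^ m - i.+1)%N%:Z - 1 = i%:Z + - (p ^ m)%N%:Z.
      by rewrite -subzn //; lia.
  over.
  have vq : v (- (p ^ m)%N%:Z)%:~R <= p%:R ^- m.
    by rewrite mulrNz absN -[(p ^ m)%N]mul1n abs_mul_pX.
  have H : v (\sum_(n < p ^ m) (F (n%:Z - (p ^ m)%N%:Z) - F n%:Z)) <=
      c * p%:R ^- m * p%:R * p%:R ^- m.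
    apply: (@abs_sum_lip (fun a => F (a - (p ^ m)%N%:Z) - F a)) => [a|a h].
      by apply: le_trans (smooth_lip sF _ _) _; rewrite ler_wpM2l.
    have := smooth_lip2 sF a (- (p ^ m)%N%:Z) h.
    rewrite (_ : _ - _ = F (a + h - (p ^ m)%N%:Z) - F (a + h) -
      (F (a - (p ^ m)%N%:Z) - F a)); last by rewrite (addrAC a); ring.
    move=> H; apply: le_trans H _; rewrite mulrA ler_wpM2r ?abs_ge0 //.
    by rewrite ler_wpM2l.
  apply: le_trans (ler_wpM2l _ H) _; first by rewrite exprn_ge0.
  rewrite le_eqVlt; apply/orP; left; apply/eqP.
  by field; rewrite expf_neq0 ?gt_eqF.
have := vcvgD H Fl; rewrite add0r; apply: vcvg_ext => m.
by rewrite subrK.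
Qed.

End Volkenborn.

Hypothesis complete : forall u : nat -> K, vcauchy v u -> exists l, vcvg v u l.

(** By the ultrametric inequality small consecutive differences already make a Cauchy sequence.
    Completeness enters the proof here. *)
Lemma vcvg_step (u : nat -> K) c :
  (forall m, v (u m.+1 - u m) <= c * p%:R ^- m) -> exists l, vcvg v u l.
Proof.
move=> uc; have c0 : 0 <= c.
  by have := uc 0%N; rewrite expr0 invr1 mulr1; apply: le_trans; exact: abs_ge0.
have Sm k m : v (u (k + m)%N - u m) <= c * p%:R ^- m.
  elim: k => [|k IHk]; first by rewrite subrr abs0 mulr_ge0.
  rewrite addSn; apply: abs_triangle IHk; apply: le_trans (uc _) _.
  rewrite ler_wpM2l // lef_pV2 ?posrE ?exprn_gt0 //.
  by rewrite ler_weXn2l ?leq_addl // ler1n prime_gt0.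
apply: complete => e /(invpX_small c)[N NP]; exists N => m n Nm Nn.
rewrite -(subrKA (u N)); apply: absD_lt; last rewrite absBC.
  by rewrite -(subnK Nm); apply: le_lt_trans (Sm _ _) (NP _ _).
by rewrite -(subnK Nn); apply: le_lt_trans (Sm _ _) (NP _ _).
Qed.

Lemma volkenborn_ex c F : smooth c F -> exists l, volkenborn F l.
Proof.
move=> sF; apply: (@vcvg_step _ (c * p%:R ^+ 2)) => m; exact: volk_sum_step.
Qed.

(** * Derivatives of the log gamma function *)

Section Psi.
Variable lg : K -> K.
Hypothesis lgP : iwasawa_log p v lg.
Implicit Types (c r : R) (T : int -> K).

Lemma abs_nat_invS n : (v n.+1%:R)^-1 <= n.+1%:R.
Proof.
by rewrite -[leRHS]invrK lef_pV2 ?posrE ?abs_nat_ge // ?abs_gt0 ?abs_nat_neq0 ?invr_gt0 ?ltr0n.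
Qed.

(** The geometric sum is at most 1/(1 - r) and each of its [n] terms is at least [r ^+ n]. As 1/|n|
    <= n, this bounds all terms of the logarithm series uniformly. *)
Lemma natr_geometric_le r n : 0 <= r < 1 -> n%:R * r ^+ n <= (1 - r)^-1.
Proof.
move=> /andP[r0 r1]; have s0 : 0 < 1 - r by rewrite subr_gt0.
rewrite -[leRHS]mul1r ler_pdivlMr //.
have : (1 - r) * (\sum_(i < n) r ^+ i) <= 1.
  have := subrX1 r n => E; rewrite -[1 - r]opprB mulNr -E opprB.
  by rewrite gerBl exprn_ge0.
apply: le_trans; rewrite mulrC ler_pM2l //.
rewrite mulr_natl -[n in _ *+ n]card_ord -sumr_const ler_sum // => i _.
by rewrite ler_wiXn2l ?(ltW r1) // ltnW.
Qed.

Lemma smooth_log1p r T : r < 1 -> smooth r T ->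
  smooth (1 - r)^-1 (fun a => lg (1 + T a)).
Proof.
move=> r1 sT; have r0 := smooth_ge0 sT; apply: smooth_lim; last first.
  move=> a; apply: (ilog_series lgP).
  exact: le_lt_trans (smooth_bound sT a) r1.
move=> N; apply: smooth_sum => [|n _]; first by rewrite invr_ge0 subr_ge0 ltW.
have := smoothZ ((-1) ^+ n * n.+1%:R^-1) (smoothX n.+1 sT).
move=> /(smooth_ext (G := fun a => (-1) ^+ n * T a ^+ n.+1 / n.+1%:R)) sZ.
apply: smooth_le (sZ _) => [|a]; last by rewrite mulrAC.
rewrite absM absX absN abs1 expr1n mul1r absV.
apply: le_trans (natr_geometric_le n.+1 _); last by rewrite r0.
by rewrite ler_wpM2r ?exprn_ge0 // abs_nat_invS.
Qed.

(** The function is the series of (-1)^k T^k/(k+1) over k >= 1, and it matters that the constant is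
    proportional to [r]. With [r <= 1/2] the terms are bounded by (n+2) 2^(-n) r <= 2 r. *)
Lemma smooth_log1p_rem r T : r <= 2^-1 -> smooth r T -> (forall a, T a != 0) ->
  smooth (2 * r) (fun a => lg (1 + T a) / T a - 1).
Proof.
move=> r2 sT T0; have r0 := smooth_ge0 sT.
have E n a : \sum_(k < n) (-1) ^+ k.+1 * T a ^+ k.+1 / k.+2%:R =
    (\sum_(k < n.+1) (-1) ^+ k * T a ^+ k.+1 / k.+1%:R) / T a - 1.
  rewrite big_ord_recl /= expr0 expr1 mul1r divr1 mulrDl mulfV // addrAC subrr add0r.
  rewrite mulr_suml; apply: eq_bigr => k _.
  rewrite /bump add1n [T a ^+ k.+2]exprSr; field.
  by rewrite T0 -natrD abs_nat_neq0.
apply: (@smooth_lim _ (fun n a => \sum_(k < n) (-1) ^+ k.+1 * T a ^+ k.+1 / k.+2%:R)).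
  move=> N; apply: smooth_sum => [|n _]; first by rewrite mulr_ge0.
  have := smoothZ ((-1) ^+ n.+1 * n.+2%:R^-1) (smoothX n.+1 sT).
  move=> /(smooth_ext (G := fun a => (-1) ^+ n.+1 * T a ^+ n.+1 / n.+2%:R)) sZ.
  apply: smooth_le (sZ _) => [|a]; last by rewrite mulrAC.
  rewrite absM absX absN abs1 expr1n mul1r absV exprSr mulrA.
  rewrite ler_wpM2r //; apply: (@le_trans _ _ (n.+2%:R * 2^-1 ^+ n)).
    by rewrite ler_pM ?invr_ge0 ?abs_ge0 ?exprn_ge0 ?abs_nat_invS ?lerXn2r ?nnegrE ?invr_ge0.
  rewrite exprVn ler_pdivrMr ?exprn_gt0 // -exprS -natrX ler_nat.
  exact: ltn_expl.
move=> a; apply: vcvg_ext (fun n => esym (E n a)) _.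
apply: vcvgB (vcvg_cst _); rewrite mulrC.
have Ta1 : v (T a) < 1.
  by apply: le_lt_trans (smooth_bound sT a) _; apply: le_lt_trans r2 _; lra.
have /(vcvgZ (T a)^-1) := (vcvg_shift 1 _ _).2 (ilog_series lgP Ta1).
by apply: vcvg_ext => n; rewrite addn1 mulrC.
Qed.

Section Shift.
Variable y : K.
Hypothesis y1 : 1 < v y.

Let y0 : y != 0. Proof. by rewrite -abs_gt0 (lt_trans _ y1). Qed.

Lemma abs_shift (a : int) : v (y + a%:~R) = v y.
Proof. by rewrite absD_eq // (le_lt_trans (abs_int a)). Qed.

Lemma shift_neq0 (a : int) : y + a%:~R != 0.
Proof. by rewrite -abs_gt0 abs_shift abs_gt0. Qed.

Lemma smooth_shift_quo : smooth (v y)^-1 (fun a => a%:~R / y).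
Proof.
have := smoothZ y^-1 smooth_int; rewrite absV mulr1.
by apply: smooth_ext => a; rewrite mulrC.
Qed.

Lemma smooth_shift1 : smooth 1 (fun a => 1 + a%:~R / y).
Proof.
apply: smoothD; first by apply: smooth_cst; rewrite abs1.
apply: smooth_le smooth_shift_quo.
by rewrite invf_le1 ?ltW // (lt_trans _ y1).
Qed.

Lemma smooth_shiftV : smooth (v y)^-1 (fun a => (y + a%:~R)^-1).
Proof.
have F1 (a : int) : 1 + a%:~R / y = (y + a%:~R) / y by field.
have F1v (a : int) : v (1 + a%:~R / y) = 1.
  by rewrite F1 absM absV abs_shift mulfV ?gt_eqF // (lt_trans _ y1).
have := smoothZ y^-1 (smoothV smooth_shift1 F1v); rewrite absV mulr1.
by apply: smooth_ext => a; rewrite F1; field; rewrite y0 shift_neq0.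
Qed.

(** lg (y + a) = lg y + lg (1 + a/y), where |a/y| <= 1/|y| < 1 puts the second term in the range of
    the series. *)
Lemma smooth_log_shift : exists c, smooth c (fun a => lg (y + a%:~R)).
Proof.
have v1 : (v y)^-1 < 1 by rewrite invf_lt1 // (lt_trans _ y1).
have s1 := smooth_log1p v1 smooth_shift_quo.
exists (Num.max (v (lg y)) (1 - (v y)^-1)^-1).
have s2 : smooth (Num.max (v (lg y)) (1 - (v y)^-1)^-1) (fun=> lg y).
  by apply: smooth_cst; rewrite le_max lexx.
apply: smooth_ext (smoothD s2 (smooth_le _ s1)) => [a|]; last first.
  by rewrite le_max lexx orbT.
have E : y + a%:~R = y * (1 + a%:~R / y) by field.
rewrite E (ilogM lgP) //.
by apply/eqP => E1; have := shift_neq0 a; rewrite E E1 mulr0 eqxx.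
Qed.

Lemma smooth_log_gamma_shift :
  exists c, smooth c (fun a => (y + a%:~R) * lg (y + a%:~R) - (y + a%:~R)).
Proof.
have [c sc] := smooth_log_shift.
have sy : smooth (v y) (fun a => y + a%:~R).
  apply: smoothD; first exact: smooth_cst.
  by apply: smooth_le smooth_int; exact: ltW.
have c0 := smooth_ge0 sc; have y_ge0 := abs_ge0 y.
exists (v y * c + v y); apply: smoothB.
  by apply: smooth_le (smoothM sy sc); rewrite lerDl.
by apply: smooth_le sy; rewrite lerDr mulr_ge0.
Qed.

End Shift.

(** * Differentiation under the Volkenborn integral *)

Lemma is_vderiv_unique f x d e : is_vderiv v f x d -> is_vderiv v f x e -> d = e.
Proof.
move=> fd fe; apply/eqP; rewrite -subr_eq0 -abs_eq0.
rewrite eq_le abs_ge0 andbT leNgt; apply/negP => de.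
have [r r0 rP] := fd _ de; have [s s0 sP] := fe _ de.
(* A power of p is a nonzero increment small enough for both difference quotients. *)
have [N NP] := invpX_small 1 r0; have [M MP] := invpX_small 1 s0.
have h0 := pX_neq0 (maxn N M); set h := _ ^+ _ in h0.
have vh : v h = 1 * p%:R ^- maxn N M by rewrite mul1r abs_pX.
have {}rP : v ((f (x + h) - f x) / h - d) < v (d - e).
  by apply: rP => //; rewrite vh NP // leq_maxl.
have {}sP : v ((f (x + h) - f x) / h - e) < v (d - e).
  by apply: sP => //; rewrite vh MP // leq_maxr.
by have := absB_lt sP rP; rewrite opprB addrC subrKA ltxx.
Qed.

Lemma vderivE f x d : is_vderiv v f x d -> vderiv v f x = d.
Proof. by move=> fd; apply: xget_unique => // e fe; exact: is_vderiv_unique fe fd. Qed.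

(* The difference quotients of the integral are the integrals of the difference
   quotients, and the remainder is controlled because it is smooth with a
   constant proportional to the increment. *)
Lemma volkenborn_deriv (f g : K -> K) (I : K -> K) (y d : K) :
  1 < v y ->
  (forall z, 1 < v z -> volkenborn (fun a => f (z + a%:~R)) (I z)) ->
  volkenborn (fun a => g (y + a%:~R)) d ->
  (forall h, h != 0 -> v h <= 2^-1 ->
    smooth (2 * v h) (fun a =>
      (f (y + a%:~R + h) - f (y + a%:~R)) / h - g (y + a%:~R))) ->
  is_vderiv v I y d.
Proof.
move=> y1 fI gd sR e e0.
have c0 : 0 < 2 * (p%:R : R) ^+ 2 by rewrite mulr_gt0 // exprn_gt0.
have r0 : 0 < e / (2 * p%:R ^+ 2) by rewrite divr_gt0.
(* The bound 1/2 makes the smoothness hypothesis applicable; the other bound turns the estimate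
   [2 |h| p^2] of [volkenborn_bound] into one by [e]. *)
exists (Num.min 2^-1 (e / (2 * p%:R ^+ 2))); first by rewrite lt_min r0 invr_gt0 ltr0n.
move=> h h0; rewrite lt_min => /andP[h2 he].
have yh : v (y + h) = v y.
  by rewrite absD_eq // (lt_trans h2) // (lt_trans _ y1); lra.
have Ih : volkenborn (fun a =>
    (f (y + a%:~R + h) - f (y + a%:~R)) / h - g (y + a%:~R))
    ((I (y + h) - I y) / h - d).
  apply: volkenbornB gd; rewrite mulrC.
  have := volkenbornZ h^-1 (volkenbornB (fI (y + h) _) (fI y y1)).
  rewrite yh => /(_ y1); apply: volkenborn_ext => n.
  by rewrite mulrC addrAC.
apply: le_lt_trans (volkenborn_bound (sR h h0 (ltW h2)) Ih) _.
by move: he; rewrite ltr_pdivlMr // mulrCA mulrA.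
Qed.

Lemma smooth_quo_shift y h : 1 < v y -> smooth (v h) (fun a => h / (y + a%:~R)).
Proof.
move=> y1; have := smoothZ h (smooth_shiftV y1); apply: smooth_le.
rewrite ler_piMr ?abs_ge0 // invf_le1 ?ltW //; exact: lt_trans y1.
Qed.

Lemma log_shift_quotient x h : x != 0 -> 1 + h / x != 0 ->
  lg (x + h) = lg x + lg (1 + h / x).
Proof.
by move=> x0 hx; rewrite -(ilogM lgP) //; congr lg; field.
Qed.

Lemma shift_quo_neq0 y h (a : int) : 1 < v y -> v h <= 2^-1 ->
  1 + h / (y + a%:~R) != 0.
Proof.
move=> y1 h2; rewrite -abs_gt0 absD_eq ?abs1 //.
apply: le_lt_trans (smooth_bound (smooth_quo_shift h y1) a) _.
by apply: le_lt_trans h2 _; lra.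
Qed.

Lemma log_gamma_deriv y d : 1 < v y ->
  volkenborn (fun a => lg (y + a%:~R)) d -> is_vderiv v (log_gamma p v lg) y d.
Proof.
move=> y1 yd; apply: (volkenborn_deriv (f := fun x => x * lg x - x) y1 _ yd).
  move=> z z1; have [c sc] := smooth_log_gamma_shift z1.
  have [l zl] := volkenborn_ex sc.
  by rewrite (_ : log_gamma _ _ _ _ = l) //; exact: vlimE.
move=> h h0 h2; have sT := smooth_quo_shift h y1.
have T0 (a : int) : h / (y + a%:~R) != 0.
  by rewrite mulf_neq0 // invr_eq0 shift_neq0.
have sL := smooth_log1p_rem h2 sT T0.
have h1 : v h <= 1 by lra.
(* With x = y + a, T = h/x and L = lg (1 + T)/T - 1, the remainder of the difference quotient of x
   lg x - x is L + T L + T. *)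
apply: smooth_ext (smoothD (smoothD sL (smooth_le _ (smoothM sT sL)))
  (smooth_le _ sT)); last 2 first.
- by rewrite ler_piMl // mulr_ge0 // abs_ge0.
- by rewrite ler_peMl ?abs_ge0 //; lra.
move=> a; rewrite (log_shift_quotient (shift_neq0 y1 a) (shift_quo_neq0 a y1 h2)).
by field; rewrite h0 shift_neq0.
Qed.

Lemma psi_deriv y d : 1 < v y ->
  volkenborn (fun a => (y + a%:~R)^-1) d -> is_vderiv v (psi p v lg) y d.
Proof.
move=> y1 yd; apply: (volkenborn_deriv (f := lg) (g := GRing.inv) y1 _ yd).
  move=> z z1; have [c sc] := smooth_log_shift z1.
  have [l zl] := volkenborn_ex sc.
  by rewrite (_ : psi _ _ _ _ = l) //; apply: vderivE; exact: log_gamma_deriv.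
move=> h h0 h2; have sT := smooth_quo_shift h y1.
have T0 (a : int) : h / (y + a%:~R) != 0.
  by rewrite mulf_neq0 // invr_eq0 shift_neq0.
have sL := smooth_log1p_rem h2 sT T0.
(* In the same notation the remainder of the difference quotient of [lg] is L/x. *)
apply: smooth_ext (smooth_le _ (smoothM (smooth_shiftV y1) sL)) => [a|].
  rewrite (log_shift_quotient (shift_neq0 y1 a) (shift_quo_neq0 a y1 h2)).
  by field; rewrite h0 shift_neq0.
rewrite ler_piMl ?mulr_ge0 ?abs_ge0 // invf_le1 ?ltW //; exact: lt_trans y1.
Qed.

Lemma psi'_volkenborn y : 1 < v y ->
  volkenborn (fun a => (y + a%:~R)^-1) (vderiv v (psi p v lg) y).
Proof.
move=> y1; have [l yl] := volkenborn_ex (smooth_shiftV y1).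
by rewrite (vderivE (psi_deriv y1 yl)).
Qed.

Lemma integrand_volkenborn j x : (2 <= j)%N -> v x < 1 ->
  volkenborn (fun a => x ^+ (j - 2) / (1 + x * a%:~R)) (integrand p v lg j x).
Proof.
move=> j2 x1; rewrite /integrand; case: eqVneq => [x0|x0].
  apply: volkenborn_ext (volkenborn_cst _) => n.
  rewrite x0 mul0r addr0 divr1; apply: vlimE.
  (* Only the term [n = j - 2] can survive, with B_0 = 1; for [j = 2] it is [0 ^+ 0 = 1], as is the
     integrand on the Volkenborn side. *)
  apply: (@vcvg_eventually (j - 1)%N (fun=> 0 ^+ (j - 2))); last exact: vcvg_cst.
  move=> N jN; rewrite big_ltn; last by lia.
  rewrite subnn big_nat big1 ?addr0 => [|k /andP[jk _]].
    rewrite -[LHS]mul1r; congr (_ * _).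
    by rewrite /bern /gbern /= big_nat1 big_ord0 expr0 !mul1r subr0 invr1 !mulr1.
  by rewrite expr0n (_ : k == 0%N = false) ?mulr0 //; lia.
have V : 1 < v x^-1 by rewrite absV invf_gt1 // abs_gt0.
rewrite (_ : x ^ (j%:Z - 3) = x ^+ (j - 2) / x); last first.
  rewrite (_ : j%:Z - 3 = (j - 2)%N%:Z - 1); last by lia.
  by rewrite expfzDr // exprN1.
apply: volkenborn_ext (volkenbornZ _ (psi'_volkenborn V)) => n.
have d0 := shift_neq0 V n; field; rewrite x0 /=.
have : x * (x^-1 + n%:~R) != 0 by rewrite mulf_neq0.
by rewrite mulrDr mulfV // andbT.
Qed.

End Psi.

(** * The Teichmuller character *)

Section Teichmuller.
Implicit Types (x y z w : K) (a b : int).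

Lemma abs_frobenius x y : v x <= 1 -> v y <= 1 ->
  v ((x + y) ^+ p - x ^+ p - y ^+ p) <= p%:R^-1.
Proof.
move=> x1 y1; have Ep : p = p.-1.+1 by rewrite prednK ?prime_gt0.
have -> : (x + y) ^+ p - x ^+ p - y ^+ p =
    \sum_(i < p.-1) x ^+ (p - i.+1) * y ^+ i.+1 *+ 'C(p, i.+1).
  rewrite exprDn big_ord_recl Ep big_ord_recr /= -Ep.
  rewrite subn0 bin0 /bump leq0n add1n -Ep subnn binn !expr0 mulr1 mul1r.
  rewrite !mulr1n addrAC addrA addrK [x ^+ p + _]addrC addrK.
  by apply: eq_bigr => i _; rewrite leq0n add1n.
apply: abs_sum => [|i _]; first by rewrite invr_ge0.
have /dvdnP[m ->] : (p %| 'C(p, i.+1))%N.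
  by apply: prime_dvd_bin => //=; have := ltn_ord i; lia.
rewrite mulrnA -[_ *+ p]mulr_natr absM (pabs_p vP) ler_piMl ?invr_ge0 //.
rewrite -[_ *+ m]mulr_natr !absM !absX.
by rewrite !mulr_ile1 ?mulr_ge0 ?exprn_ge0 ?exprn_ile1 ?abs_ge0 ?abs_nat.
Qed.

Lemma abs_fermat a : v (a%:~R ^+ p - a%:~R) <= p%:R^-1.
Proof.
have i0 : 0 <= p%:R^-1 :> R by rewrite invr_ge0.
elim/int_ind: a => [|n|n].
- by rewrite mulr0z expr0n gtn_eqF ?prime_gt0 // subr0 abs0.
- rewrite -addn1 PoszD intrD => IHn.
  rewrite (_ : _ - _ = ((n%:~R + 1%:~R) ^+ p - n%:~R ^+ p - 1 ^+ p) +
    (n%:~R ^+ p - n%:~R)); last by rewrite expr1n; ring.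
  by apply: absD => //; apply: abs_frobenius; rewrite ?abs1 ?abs_int.
- rewrite -addn1 PoszD opprD intrD => IHn.
  rewrite -(addrNK 1 (- n%:Z)) intrD in IHn.
  set t := (- n%:Z - 1)%:~R in IHn *; rewrite -intrD -/t.
  rewrite (_ : _ - _ = ((t + 1%:~R) ^+ p - (t + 1%:~R)) -
    ((t + 1%:~R) ^+ p - t ^+ p - 1 ^+ p)); last by rewrite expr1n; ring.
  by apply: absB => //; apply: abs_frobenius; rewrite ?abs1 ?abs_int.
Qed.

(** The cofactor of x - y in x^p - y^p is congruent to p x^(p-1) modulo x - y, hence has absolute
    value at most 1/p. *)
Lemma abs_expp_sub x y s : v x <= 1 -> v y <= 1 ->
  v (x - y) <= p%:R ^- s.+1 -> v (x ^+ p - y ^+ p) <= p%:R ^- s.+2.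
Proof.
move=> x1 y1 xy; rewrite subrXX absM exprS invfM mulrC ler_pM ?abs_ge0 //.
have xyp : v (x - y) <= p%:R^-1.
  apply: le_trans xy _; rewrite lef_pV2 ?posrE ?exprn_gt0 //.
  by rewrite ler_eXnr // ler1n prime_gt0.
rewrite -(subrK (x ^+ p.-1 *+ p) (\sum_(i < p) _)); apply: absD; last first.
  rewrite -mulr_natr absM (pabs_p vP) absX ler_piMl ?invr_ge0 //.
  by rewrite exprn_ile1 ?abs_ge0.
rewrite -[X in _ *+ X]card_ord -sumr_const -sumrB.
apply: abs_sum => [|i _]; first by rewrite invr_ge0.
have -> : x ^+ p.-1 = x ^+ (p.-1 - i) * x ^+ i.
  by rewrite -exprD subnK // -ltnS prednK ?prime_gt0.
rewrite -mulrBr absM.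
apply: le_trans (_ : v (y ^+ i - x ^+ i) <= _).
  by rewrite ler_piMl ?abs_ge0 // absX exprn_ile1 ?abs_ge0.
rewrite absBC subrXX absM; apply: le_trans xyp.
rewrite ler_piMr ?abs_ge0 //; apply: abs_sum => // k _.
by rewrite absM !absX mulr_ile1 ?exprn_ge0 ?exprn_ile1 ?abs_ge0.
Qed.

Lemma abs_exppX_sub x y k : v x <= 1 -> v y <= 1 -> v (x - y) <= p%:R^-1 ->
  v (x ^+ (p ^ k) - y ^+ (p ^ k)) <= p%:R ^- k.+1.
Proof.
move=> x1 y1 xy; elim: k => [|k IHk]; first by rewrite !expr1.
rewrite expnSr !exprM; apply: abs_expp_sub => //;
  by rewrite absX exprn_ile1 ?abs_ge0.
Qed.

(** In this form multiplicativity and smoothness with constant 1 pass to the limit from powers of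
    integers; [teichmuller_int] identifies it with the character defined through roots of unity. *)
Definition teich a : K := vlim v (fun k => a%:~R ^+ (p ^ k)).

Lemma teich_cvg a : vcvg v (fun k => a%:~R ^+ (p ^ k)) (teich a).
Proof.
have [|l al] := @vcvg_step (fun k => a%:~R ^+ (p ^ k)) p%:R^-1.
  move=> m; rewrite -invfM -exprS expnS exprM; apply: abs_exppX_sub.
  - by rewrite absX exprn_ile1 ?abs_ge0 ?abs_int.
  - exact: abs_int.
  - exact: abs_fermat.
by rewrite /teich (vlimE al).
Qed.

Lemma smooth_teich : smooth 1 teich.
Proof.
apply: smooth_lim teich_cvg => n.
by have := smoothX (p ^ n) smooth_int; rewrite expr1n.
Qed.

Lemma teichM a b : teich (a * b) = teich a * teich b.
Proof.
apply: vcvg_unique (teich_cvg _) _; apply: vcvg_ext (vcvgM (teich_cvg a) (teich_cvg b)) => k.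
by rewrite intrM exprMn.
Qed.

Lemma teich_mod a b : (p%:Z %| a - b)%Z -> teich a = teich b.
Proof.
move=> /abs_int_le_invp; rewrite intrB => ab.
apply/eqP; rewrite -subr_eq0; apply/eqP.
apply: vcvg_unique (vcvgB (teich_cvg a) (teich_cvg b)) _.
apply: (@vcvg_rate _ _ p%:R^-1) => k.
by rewrite subr0 -invfM -exprS abs_exppX_sub ?abs_int.
Qed.

Lemma abs_fermatX a k : v (a%:~R - a%:~R ^+ (p ^ k)) <= p%:R^-1.
Proof.
elim: k => [|k IHk]; first by rewrite subrr abs0 invr_ge0.
apply: abs_triangle IHk _; rewrite absBC expnS exprM.
apply: le_trans (abs_exppX_sub k _ _ (abs_fermat a)) _.
- by rewrite absX exprn_ile1 ?abs_ge0 ?abs_int.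
- exact: abs_int.
- rewrite lef_pV2 ?posrE ?exprn_gt0 //.
  by rewrite ler_eXnr // ler1n prime_gt0.
Qed.

Lemma teich_near a : v (a%:~R - teich a) < 1.
Proof.
apply: le_lt_trans invp_lt1.
apply: (vcvg_le _ (vcvgB (vcvg_cst a%:~R) (teich_cvg a))) => k.
exact: abs_fermatX.
Qed.

Lemma teich_dvd a : (p%:Z %| a)%Z -> teich a = 0.
Proof.
move=> pa; rewrite (@teich_mod a 0) ?subr0 //.
apply: vlimE; apply: vcvg_ext (vcvg_cst 0) => k.
by rewrite mulr0z expr0n expn_eq0 (gtn_eqF (prime_gt0 p_pr)).
Qed.

Lemma teich_unit a : ~~ (p%:Z %| a)%Z -> v (teich a) = 1.
Proof.
move=> pa; rewrite -(subrK a%:~R (teich a)) addrC absD_eq.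
  exact: abs_int_unit.
by rewrite (abs_int_unit pa) absBC teich_near.
Qed.

Lemma teich_root a : ~~ (p%:Z %| a)%Z -> teich a ^+ p.-1 = 1.
Proof.
move=> pa; have t0 : teich a != 0 by rewrite -abs_gt0 teich_unit.
apply: (mulfI t0); rewrite -exprS prednK ?prime_gt0 // mulr1.
apply: vcvg_unique (vcvgX p (teich_cvg a)) _.
have := (vcvg_shift 1 _ _).2 (teich_cvg a); apply: vcvg_ext => k.
by rewrite addn1 expnSr exprM.
Qed.

(** If u = z/w were not 1, the sum of u^i over i < nm would vanish; but it is congruent to nm modulo
    u - 1, and |nm| = 1. *)
Lemma unity_root_near_inj n m z w : (0 < n)%N -> (0 < m)%N ->
  coprime p n -> coprime p m -> z ^+ n = 1 -> w ^+ m = 1 -> v (z - w) < 1 ->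
  z = w.
Proof.
move=> n0 m0 pn pm zn wm zw.
have w0 : w != 0.
  by apply/eqP => w0; move/eqP: wm; rewrite w0 expr0n gtn_eqF // eq_sym oner_eq0.
have vw : v w = 1.
  by apply/eqP; rewrite -(@pexpr_eq1 _ _ m) ?abs_ge0 // -absX wm abs1.
set u := z / w; have u1 : v (u - 1) < 1.
  by rewrite /u -(divff w0) -mulrBl absM absV vw invr1 mulr1.
have vu : v u = 1 by rewrite -(subrK 1 u) addrC absD_eq abs1.
have uN : u ^+ (n * m) = 1.
  by rewrite expr_div_n exprM zn [in w ^+ _]mulnC exprM wm !expr1n divr1.
suff : u - 1 == 0 by rewrite subr_eq0 => /eqP E; rewrite -(divfK w0 z) -/u E mul1r.
have : (u - 1) * \sum_(i < n * m) u ^+ i = 0 by rewrite -subrX1 uN subrr.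
move=> /eqP; rewrite mulf_eq0 => /orP[//|/eqP S0].
have : v ((n * m)%:R) = 1 by apply: abs_nat_coprime; rewrite coprimeMr pn.
rewrite -[(n * m)%:R]subr0 -S0 -[in (n * m)%:R](card_ord (n * m)) -sumr_const -sumrB.
have H : v (\sum_(i < n * m) (1 - u ^+ i)) <= v (u - 1).
  apply: abs_sum => [|i _]; first exact: abs_ge0.
  rewrite absBC subrX1 absM ler_piMr ?abs_ge0 //.
  by apply: abs_sum => // k _; rewrite absX vu expr1n.
by move=> E; move: (le_lt_trans H u1); rewrite E ltxx.
Qed.

Lemma coprime_pred_p : coprime p p.-1.
Proof. by rewrite coprimenP ?prime_gt0. Qed.

Lemma teichmullerE x z : z ^+ p.-1 = 1 -> v (x - z) < 1 -> teichmuller p v x = z.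
Proof.
move=> zp xz; have p1 : (0 < p.-1)%N by rewrite -subn1 subn_gt0 prime_gt1.
have vz : v z = 1.
  by apply/eqP; rewrite -(@pexpr_eq1 _ _ p.-1) ?abs_ge0 // -absX zp abs1.
have vx : v x = 1 by rewrite -(subrK z x) addrC absD_eq vz.
rewrite /teichmuller vx eqxx; apply: xget_unique.
  split=> //; have [m zm mp] := prim_order_exists p1 zp.
  exists m => //; rewrite coprime_sym; exact: coprime_dvdr mp coprime_pred_p.
move=> w /= [[n np wn] xw].
have wz : v (w - z) < 1.
  by rewrite -(subrKA x) absD_lt // absBC.
apply: (unity_root_near_inj (prim_order_gt0 wn) p1 _ coprime_pred_p _ zp wz).
  by rewrite coprime_sym.
exact: prim_expr_order.
Qed.

Lemma teichmuller_small x : v x < 1 -> teichmuller p v x = 0.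
Proof. by rewrite /teichmuller => /lt_eqF ->. Qed.

Lemma teichmuller_int a : teichmuller p v a%:~R = teich a.
Proof.
have [pa|pa] := boolP (p%:Z %| a)%Z; last first.
  by apply: teichmullerE (teich_near a); exact: teich_root.
rewrite teich_dvd // teichmuller_small //.
exact: le_lt_trans (abs_int_le_invp pa) invp_lt1.
Qed.

Lemma omega_powE k a : omega_pow p v k a = if (p%:Z %| a)%Z then 0 else teich a ^ k.
Proof. by rewrite /omega_pow teichmuller_int. Qed.

Lemma omega_pow_dirichlet k : dirichlet_character p (omega_pow p v k).
Proof.
split=> [|a|a b|a]; first exact: prime_gt0.
- rewrite !omega_powE rpredDr ?dvdzz // (@teich_mod (a + p) a) //.
  by rewrite addrAC subrr add0r dvdzz.
- rewrite !omega_powE.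
  have -> : (p%:Z %| a * b)%Z = (p%:Z %| a)%Z || (p%:Z %| b)%Z.
    by rewrite !dvdzE abszM Euclid_dvdM.
  have [pa|pa] := boolP (p%:Z %| a)%Z; first by rewrite mul0r.
  by have [pb|pb] := boolP (p%:Z %| b)%Z; rewrite ?mulr0 // teichM expfzMl.
- rewrite omega_powE coprimez_sym; case: ifPn => pa.
    split; first by rewrite eqxx.
    by rewrite coprimezE prime_coprime // -dvdzE pa.
  split=> _; first by rewrite coprimezE prime_coprime.
  by rewrite expfz_neq0 // -abs_gt0 teich_unit.
Qed.

End Teichmuller.

(** * L-values as Volkenborn integrals *)

Section LValues.
Implicit Types (chi : int -> K) (n m e : nat).

(** The sum over 0 <= a < f + q can be cut at [f] or at [q]. With q = p^m this trades differences by
    a period, which the binomial theorem expands, for differences by p^m, which tend to a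
    derivative. *)
Lemma sum_shift_swap (H : int -> K) (f q : nat) :
  \sum_(a < q) (H (a%:Z + f%:Z) - H a%:Z) =
  \sum_(a < f) (H (a%:Z + q%:Z) - H a%:Z).
Proof.
have split n m : \sum_(a < n + m) H a%:Z =
    \sum_(a < n) H a%:Z + \sum_(a < m) H (a%:Z + n%:Z).
  rewrite big_split_ord; congr (_ + _).
  by apply: eq_bigr => a _; rewrite addrC.
have := split f q; rewrite addnC split !sumrB => E.
rewrite (_ : \sum_(a < q) H (a%:Z + f%:Z) = \sum_(a < q) H a%:Z +
  \sum_(a < f) H (a%:Z + q%:Z) - \sum_(a < f) H a%:Z); first by ring.
by rewrite E; ring.
Qed.

Lemma vcvg_pX_diff x n :
  vcvg v (fun m => p%:R ^- m * ((x + p%:R ^+ m) ^+ n.+1 - x ^+ n.+1))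
    (n.+1%:R * x ^+ n).
Proof.
have xp : vcvg v (fun m => x + p%:R ^+ m) x.
  by apply: (@vcvg_rate _ _ 1) => m; rewrite addrAC subrr add0r abs_pX mul1r.
rewrite (_ : _ * _ = \sum_(i < n.+1) x ^+ n); last first.
  by rewrite sumr_const card_ord mulr_natl.
apply: (@vcvg_ext (fun m =>
    \sum_(i < n.+1) (x + p%:R ^+ m) ^+ (n - i) * x ^+ i)) => [m|].
  by rewrite subrXX addrAC subrr add0r mulKf ?pX_neq0.
apply: vcvg_sum => i _.
rewrite (_ : x ^+ n = x ^+ (n - i) * x ^+ i); last first.
  by rewrite -exprD subnK // -ltnS.
exact: vcvgM (vcvgX _ xp) (vcvg_cst _).
Qed.

(* The Volkenborn integrals satisfy the recursion defining the generalized
   Bernoulli numbers: summing f(a + f) - f(a) over a period telescopes. *)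
Lemma gbern_volkenborn (c : nat) chi n :
  (forall a, chi (a + (p ^ c)%N%:Z) = chi a) ->
  volkenborn (fun a => chi (a + 1) * (a + 1)%:~R ^+ n) (gbern (p ^ c) chi n).
Proof.
set f := (p ^ c)%N => chi_per; have f0 : (0 < f)%N by rewrite expn_gt0 prime_gt0.
have chi_mul a k : chi (a + (k * f)%N%:Z) = chi a.
  by elim: k => [|k IHk]; rewrite ?addr0 // mulSn addnC PoszD addrA chi_per.
have fK0 : f%:R != 0 :> K by rewrite abs_nat_neq0.
elim/ltn_ind: n => n IHn.
pose S k := volk_sum (fun a => chi (a + 1) * (a + 1)%:~R ^+ k).
have n0 : n.+1%:R != 0 :> K by rewrite abs_nat_neq0.
pose D m := \sum_(a < f) chi (a%:Z + 1) *
  (p%:R ^- m * (((a%:Z + 1)%:~R + p%:R ^+ m) ^+ n.+1 - (a%:Z + 1)%:~R ^+ n.+1)).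
(* From m = c on, p^m is a multiple of the period, so translation by p^m leaves [chi] unchanged. *)
have SE m : (c <= m)%N ->
    \sum_(k < n.+1) 'C(n.+1, k)%:R * f%:R ^+ (n.+1 - k) * S k m = D m.
  move=> cm; pose H (a : int) : K := chi (a + 1) * (a + 1)%:~R ^+ n.+1.
  have -> : D m = p%:R ^- m * \sum_(a < f) (H (a%:Z + (p ^ m)%N%:Z) - H a%:Z).
    rewrite mulr_sumr; apply: eq_bigr => a _; rewrite /H addrAC.
    have -> : chi (a%:Z + 1 + (p ^ m)%N%:Z) = chi (a%:Z + 1).
      by rewrite -(subnK cm) expnD chi_mul.
    have qE : (p ^ m)%N%:Z%:~R = p%:R ^+ m :> K by rewrite -natrX.
    by rewrite [(_ + (p ^ m)%N%:Z)%:~R]intrD qE -mulrBr mulrCA.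
  rewrite -sum_shift_swap mulr_sumr.
  under eq_bigr => k _ do rewrite /S /volk_sum mulrCA !mulr_sumr.
  rewrite exchange_big /=; apply: eq_bigr => a _.
  rewrite -mulr_sumr; congr (_ * _); rewrite /H (addrAC _ f%:Z) chi_per -mulrBr.
  have -> : (a%:Z + 1 + f%:Z)%:~R = f%:R + (a%:Z + 1)%:~R :> K.
    by rewrite intrD addrC.
  rewrite exprDn [in RHS]big_ord_recr /= subnn binn mul1r mulr1n addrK mulr_sumr.
  by apply: eq_bigr => k _; rewrite -mulr_natl; ring.
have Dl : vcvg v D (n.+1%:R * \sum_(1 <= a < f.+1) chi a%:Z * a%:R ^+ n).
  rewrite big_add1 big_mkord mulr_sumr.
  apply: vcvg_sum => a _; rewrite mulrCA.
  have := vcvgZ (chi (a%:Z + 1)) (vcvg_pX_diff (a%:Z + 1)%:~R n).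
  by rewrite -[a.+1]addn1 PoszD [(_ + _)%:R]pmulrn.
have gE : gbern f chi n = (n.+1%:R * f%:R)^-1 *
    (n.+1%:R * (\sum_(1 <= a < f.+1) chi a%:Z * a%:R ^+ n) -
     \sum_(k < n) 'C(n.+1, k)%:R * f%:R ^+ (n.+1 - k) * gbern f chi k).
  rewrite -(@gbern_rec K f chi n abs_pchar0 f0) big_ord_recr /= subSnn expr1 binSn.
  by rewrite [X in X - _]addrC addrK mulKf // mulf_neq0.
(* The finite sums satisfy the Bernoulli recursion with [D m] on the right, so the one of index n is
   expressed by those of lower index, which converge by induction. *)
rewrite gE; apply: (@vcvg_eventually c (fun m => (n.+1%:R * f%:R)^-1 *
    (D m - \sum_(k < n) 'C(n.+1, k)%:R * f%:R ^+ (n.+1 - k) * S k m))) => [m cm|].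
  rewrite -(SE m cm) big_ord_recr /= subSnn expr1 binSn.
  by rewrite [X in X - _]addrC addrK mulKf // mulf_neq0.
apply: vcvgZ; apply: vcvgB Dl _; apply: vcvg_sum => k _.
exact: vcvgZ (IHn k (ltn_ord k)).
Qed.

Lemma smooth_teich_pow e n :
  smooth 1 (fun a => teich (a + 1) ^+ e * (a + 1)%:~R ^+ n).
Proof.
have := smoothM (smoothX e smooth_teich) (smoothX n smooth_int).
by rewrite !expr1n mulr1 => /(smooth_shift 1).
Qed.

(** Being p - 1 distinct roots of X^(p-1) - 1, these are all of them. *)
Definition teich_seq := [seq teich k.+1%:Z | k <- iota 0 p.-1].

Lemma dvdz_ordS k : (k < p.-1)%N -> ~~ (p%:Z %| k.+1%:Z)%Z.
Proof. by move=> kp; rewrite dvdzE /= gtnNdvd //; lia. Qed.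

Lemma teich_seq_uniq : uniq teich_seq.
Proof.
rewrite map_inj_in_uniq ?iota_uniq // => k l.
rewrite !mem_iota /= !add0n => kp lp E.
have : v (k.+1%:Z - l.+1%:Z)%:~R < 1.
  rewrite intrB -(subrKA (teich k.+1)); apply: absD_lt (teich_near _) _.
  by rewrite E absBC teich_near.
have [|/abs_int_unit ->] := boolP (p%:Z %| (k.+1%:Z - l.+1%:Z))%Z; last by rewrite ltxx.
by rewrite dvdzE /= => /dvdnP[[|t] H] _; nia.
Qed.

Lemma teich_seq_root : all (p.-1).-unity_root teich_seq.
Proof.
apply/allP => z /mapP[k]; rewrite mem_iota => /andP[_ kp] ->.
by apply/unity_rootP; rewrite teich_root // dvdz_ordS.
Qed.

Lemma omega_pow_nat e a : (0 < e)%N -> omega_pow p v e a = teich a ^+ e.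
Proof.
move=> e0; rewrite omega_powE; case: ifP => // pa.
by rewrite teich_dvd // expr0n gtn_eqF.
Qed.

(** The only proper divisor of p is 1. If the character were trivial on units, X^e - 1 would have p
    - 1 > e distinct roots. *)
Lemma omega_pow_primitive e : (0 < e < p.-1)%N ->
  primitive_character p (omega_pow p v e).
Proof.
move=> /andP[e0 ep]; split; first exact: omega_pow_dirichlet.
move=> d dp d_lt; have -> : d = 1%N.
  by have [_ /(_ _ dp)/pred2P[//|dE]] := primeP p_pr; rewrite dE ltnn in d_lt.
apply: contrapT => noa.
have : all e.-unity_root teich_seq.
  apply/allP => z /mapP[k]; rewrite mem_iota => /andP[_ kp] ->.
  apply/unity_rootP; apply: contrapT => /eqP k1; apply: noa.
  exists k.+1%:Z; split; last by rewrite omega_pow_nat.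
    by rewrite coprimez_sym coprimezE prime_coprime // -dvdzE dvdz_ordS.
  by rewrite !modz1.
move=> /(max_unity_roots e0)/(_ teich_seq_uniq).
by rewrite size_map size_iota leqNgt ep.
Qed.

Lemma trivial_primitive : primitive_character 1 (fun=> 1 : K).
Proof.
split; last by case=> [|d].
split=> // [a b|a]; first by rewrite mulr1.
by rewrite coprimezE coprimen1 oner_eq0.
Qed.

(** The weight removes the multiples of p. Their part is (p (i + 1))^n, which yields p^n from the
    power and 1/p from the change of level: this is the Euler factor. *)
Lemma volkenborn_unit n l : (0 < n)%N ->
  volkenborn (fun a => (a + 1)%:~R ^+ n) l ->
  volkenborn (fun a => teich (a + 1) ^+ p.-1 * (a + 1)%:~R ^+ n)
    ((1 - p%:R ^+ n.-1) * l).
Proof.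
move=> n0 Fl; set F := fun a : int => _ in Fl.
pose D (a : int) := F a - teich (a + 1) ^+ p.-1 * F a.
suff Dl : volkenborn D (p%:R ^+ n.-1 * l).
  rewrite mulrBl mul1r; apply: volkenborn_ext (volkenbornB Fl Dl) => a.
  by rewrite /D opprB addrC subrK.
apply/(vcvg_shift 1); apply: vcvg_ext (vcvgZ _ Fl) => m.
rewrite addn1 /volk_sum expnS sum_blocks mulrCA exprS invfM.
have -> : \sum_(i < p ^ m) \sum_(r < p) D (r%:Z + (i * p)%N%:Z) =
    \sum_(i < p ^ m) p%:R ^+ n * F i%:Z.
  apply: eq_bigr => i _.
  have split_last q (G : nat -> K) : (0 < q)%N ->
      \sum_(r < q) G r = \sum_(r < q.-1) G r + G q.-1.
    by case: q => // q _; rewrite big_ord_recr.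
  (* In each block of length p only r = p - 1 contributes, since [D] vanishes unless p divides a +
     1. *)
  rewrite (split_last p (fun r => D (r%:Z + (i * p)%N%:Z))) ?prime_gt0 //.
  rewrite big1 => [|r _].
    have E : p.-1%:Z + (i * p)%N%:Z + 1 = p%:Z * (i%:Z + 1).
      have p0 := prime_gt0 p_pr; rewrite PoszM.
      by rewrite (_ : p.-1%:Z = p%:Z - 1); [ring | lia].
    rewrite /D /F E teich_dvd ?dvdz_mulr // expr0n.
    rewrite (_ : p.-1 == 0%N = false); last by have := prime_gt1 p_pr; lia.
    by rewrite mul0r subr0 add0r intrM exprMn.
  rewrite /D teich_root ?mul1r ?subrr //.
  rewrite addrAC PoszM rpredDr ?dvdz_mull //.
  by rewrite -PoszD addn1 dvdz_ordS.
rewrite -mulr_sumr -{2}(prednK n0) exprS.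
by field; rewrite pK0 pX_neq0.
Qed.

(** Off p, omega^(s-n) is w^e. For e < p - 1 this is primitive modulo p and the Euler factor is 1;
    for e = p - 1 the primitive character is trivial of modulus 1, and the weight w^(p-1) produces
    the Euler factor. *)
Lemma KL_volkenborn (s : int) (L : K -> K) (e n : nat) (t : int) :
  kubota_leopoldt p v (omega_pow p v s) L -> (0 < e <= p.-1)%N -> (0 < n)%N ->
  s - n%:Z = e%:Z + p.-1%:Z * t ->
  volkenborn (fun a => teich (a + 1) ^+ e * (a + 1)%:~R ^+ n)
    (- n%:R * L (1 - n%:R)).
Proof.
move=> KL /andP[e0 ep] n0 sn.
have nK0 : n%:R != 0 :> K by rewrite abs_nat_neq0.
have agree a : omega_pow p v s a * omega_pow p v (- n%:Z) a != 0 ->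
    teich a ^+ e = omega_pow p v s a * omega_pow p v (- n%:Z) a.
  rewrite !omega_powE; case: ifPn => pa; first by rewrite mul0r eqxx.
  move=> _; have t0 : teich a != 0 by rewrite -abs_gt0 teich_unit.
  rewrite -expfzDr // sn expfzDr //.
  by rewrite -exprz_exp -!exprnP teich_root // exp1rz mulr1.
have [e_lt|e_ge] := ltnP e p.-1.
  have prim : primitive_character p (omega_pow p v e).
    by apply: omega_pow_primitive; rewrite e0.
  rewrite (KL_interpolation KL n0 prim).
  - rewrite omega_pow_nat // teich_dvd ?dvdzz // expr0n gtn_eqF // mul0r subr0 mul1r.
    rewrite mulrNN mulrC divfK // -[p in gbern p]expn1.
    have := @gbern_volkenborn 1 (omega_pow p v e) n.
    case: (omega_pow_dirichlet e) => _ per _ _ /(_ per).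
    by apply: volkenborn_ext => a; rewrite omega_pow_nat.
  - by move=> a /agree <-; rewrite omega_pow_nat.
have {e_ge} eE : e = p.-1 by apply/eqP; rewrite eqn_leq ep.
rewrite (KL_interpolation KL n0 trivial_primitive) => [|a sa].
  rewrite mulrNN mulrC divfK // mul1r eE; apply: volkenborn_unit => //.
  have := @gbern_volkenborn 0 (fun=> 1) n (fun=> erefl).
  by apply: volkenborn_ext => a; rewrite mul1r.
rewrite -agree // eE teich_root //.
by apply/negP => pa; move: sa; rewrite !omega_powE pa mul0r eqxx.
Qed.

Lemma Zp_in_int (a : int) : Zp_in v a%:~R.
Proof. by move=> e e0; exists a%:~R; [exists a|rewrite subrr abs0]. Qed.

Lemma KL_positive (j : nat) (L : K -> K) (e : nat) :
  (2 <= j)%N -> (0 < e <= p.-1)%N ->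
  kubota_leopoldt p v (omega_pow p v (e%:Z - j%:Z + 1)) L ->
  volkenborn (fun a => teich (a + 1) ^+ e / (a + 1)%:~R ^+ j.-1)
    ((j%:R - 1) * L j%:R).
Proof.
move=> j2 ep KL; have /andP[e0 _] := ep.
(* [1 - n k] tends p-adically to [j], and as p - 1 divides [q k], the character does not depend on
   k. The shift by [j] makes [n k] positive. *)
pose q k := (p ^ (k + j) * p.-1)%N; pose n k := (q k - j.-1)%N.
have jq k : (j.-1 < q k)%N.
  apply: leq_trans (_ : p ^ (k + j) <= _)%N.
    apply: leq_ltn_trans (_ : _ <= k + j)%N _; first by lia.
    exact/ltn_expl/prime_gt1.
  by rewrite leq_pmulr // -subn1 subn_gt0 prime_gt1.
have nk k : volkenborn (fun a => teich (a + 1) ^+ e * (a + 1)%:~R ^+ n k)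
    (- (n k)%:R * L (1 - (n k)%:R)).
  apply: (@KL_volkenborn _ L e (n k) (- (p ^ (k + j))%N%:Z) KL ep).
    by rewrite subn_gt0.
  by have := jq k; rewrite /n /q; lia.
have qcvg : vcvg v (fun k => (q k)%:R) 0.
  apply: (@vcvg_rate _ _ 1) => k; rewrite subr0 mul1r /q natrM absM natrX abs_pX.
  apply: le_trans (_ : p%:R ^- (k + j) <= _).
    by rewrite ler_piMr ?abs_nat.
  rewrite lef_pV2 ?posrE ?exprn_gt0 //.
  by rewrite ler_weXn2l ?leq_addr // ler1n prime_gt0.
have nE k : (n k)%:R = (q k)%:R - (j%:R - 1) :> K.
  by rewrite /n natrB ?(ltnW (jq k)) // -subn1 natrB // (leq_trans _ j2).
have ncvg : vcvg v (fun k => - (n k)%:R) (j%:R - 1).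
  have := vcvgN (vcvgB qcvg (vcvg_cst (j%:R - 1))); rewrite sub0r opprK.
  by apply: vcvg_ext => k; rewrite nE.
have Lcvg : vcvg v (fun k => L (1 - (n k)%:R)) (L j%:R).
  apply/vcvgP => r r0.
  have [|s s0 sP] := KL_continuous KL (Zp_in_int j) _ r0.
    (* The point j is not 1, so continuity is available for the trivial character too. *)
    left; rewrite -subr_eq0 -(natrB _ (_ : 0 < j)%N) ?abs_nat_neq0 //; lia.
  have /vcvgP/(_ s s0)[N NP] := ncvg; exists N => k /NP kN; apply: sP.
    by have := Zp_in_int (1 - (n k)%:Z); rewrite intrB.
  by move: kN; congr (v _ < s); ring.
have tcvg (a : int) : vcvg v (fun k => teich (a + 1) ^+ e * (a + 1)%:~R ^+ n k)
    (teich (a + 1) ^+ e / (a + 1)%:~R ^+ j.-1).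
  set b := a + 1; have [pb|pb] := boolP (p%:Z %| b)%Z.
    rewrite teich_dvd // expr0n gtn_eqF // mul0r.
    by apply: vcvg_ext (vcvg_cst 0) => k; rewrite mul0r.
  have b0 : b%:~R != 0 :> K by rewrite -abs_gt0 abs_int_unit.
  (* On units b^(q k) is the (p-1)-th power of b^(p^(k+j)), hence tends to w(b)^(p-1) = 1. *)
  apply: vcvgZ; rewrite (_ : _^-1 = teich b ^+ p.-1 / b%:~R ^+ j.-1); last first.
    by rewrite teich_root // mul1r.
  apply: (@vcvg_ext (fun k => (b%:~R ^+ (p ^ (k + j))) ^+ p.-1 / b%:~R ^+ j.-1)).
    by move=> k; rewrite /n expfB ?jq // /q exprM.
  apply: vcvgM (vcvg_cst _); apply: vcvgX.
  by have := teich_cvg b; rewrite -(vcvg_shift j).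
have [l Fl] : exists l, volkenborn (fun a => teich (a + 1) ^+ e / (a + 1)%:~R ^+ j.-1) l.
  exact: volkenborn_ex (smooth_lim (fun k => smooth_teich_pow e (n k)) tcvg).
have nl := volkenborn_lim (fun k => smooth_teich_pow e (n k)) tcvg nk Fl.
by rewrite (vcvg_unique (vcvgM ncvg Lcvg) nl).
Qed.

End LValues.

(** * Sums over roots of unity *)

Section UnityRootSums.

Lemma fsbig_unity_root n (rs : seq K) (F : K -> K) : (0 < n)%N ->
  all n.-unity_root rs -> uniq rs -> size rs = n ->
  \sum_(z \in [set z | z ^+ n = 1]%classic) F z = \sum_(z <- rs) F z.
Proof.
move=> n0 rs1 rsu rsn; rewrite [RHS]fsbig_seq //.
rewrite (_ : [set z | z ^+ n = 1]%classic = [set` rs]%classic) //.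
apply/seteqP; split=> z /=.
  by move=> zn; rewrite -(mem_unity_roots n0 rs1 rsu rsn); apply/unity_rootP.
by move=> zrs; apply/unity_rootP; exact: (allP rs1).
Qed.

Lemma delta_teich i :
  delta p v i = \sum_(z <- teich_seq) z ^+ i.+1 / (1 - teichmuller p v (1 - z)).
Proof.
apply: fsbig_unity_root teich_seq_root teich_seq_uniq _.
  by rewrite -subn1 subn_gt0 prime_gt1.
by rewrite size_map size_iota.
Qed.

Lemma sum_expr_unity_root n (w : K) : (0 < n)%N -> w ^+ n = 1 ->
  \sum_(i < n) w ^+ i.+1 = if w == 1 then n%:R else 0.
Proof.
move=> n0 wn; case: eqP => [->|/eqP w1].
  by under eq_bigr do rewrite expr1n; rewrite sumr_const card_ord.
under eq_bigr do rewrite exprS; rewrite -mulr_sumr.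
suff -> : \sum_(i < n) w ^+ i = 0 by rewrite mulr0.
have : (w - 1) * \sum_(i < n) w ^+ i = 0 by rewrite -subrX1 wn subrr.
by move/eqP; rewrite mulf_eq0 subr_eq0 (negPf w1) => /eqP.
Qed.

(** The difference is congruent to (a + 1) - a = 1, so the denominator of the limit kernel is a
    unit. *)
Lemma abs_teich_sub (a : int) : v (teich (a + 1) - teich a) = 1.
Proof.
rewrite (_ : _ - _ = 1 + ((a%:~R - teich a) - ((a + 1)%:~R - teich (a + 1)))).
  by rewrite absD_eq ?abs1 // absB_lt // teich_near.
by rewrite intrD; ring.
Qed.

(** 1 - 1/w(a+1) is congruent to a/(a+1), and hence to w(a)/w(a+1), which is 0 or a root of
    unity. *)
Lemma teichmuller_quo (a : int) : ~~ (p%:Z %| (a + 1))%Z ->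
  teichmuller p v (1 - (teich (a + 1))^-1) = teich a / teich (a + 1).
Proof.
move=> pa; set t := teich (a + 1); have t1 : v t = 1 by exact: teich_unit.
have t0 : t != 0 by rewrite -abs_gt0 t1.
have near : v (1 - t^-1 - teich a / t) < 1.
  have -> : 1 - t^-1 - teich a / t =
      ((a%:~R - teich a) - ((a + 1)%:~R - t)) / t by rewrite intrD; field.
  by rewrite absM absV t1 invr1 mulr1 absB_lt // teich_near.
have [pa'|pa'] := boolP (p%:Z %| a)%Z.
  rewrite teich_dvd // mul0r subr0 in near *.
  exact: teichmuller_small.
by apply: teichmullerE near; rewrite expr_div_n !teich_root // divr1.
Qed.

Lemma sum_delta (a : int) : \sum_(i < p.-1) delta p v i * teich (a + 1) ^+ i.+1 =
  (p%:R - 1) * (teich (a + 1) / (teich (a + 1) - teich a)).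
Proof.
have p1 : (0 < p.-1)%N by rewrite -subn1 subn_gt0 prime_gt1.
under eq_bigr => i _ do rewrite delta_teich mulr_suml.
rewrite exchange_big /=; set t := teich (a + 1).
under eq_bigr => z _.
  under eq_bigr => i _ do rewrite mulrAC -exprMn.
  rewrite -mulr_suml; over.
(* If p divides a + 1 both sides vanish, all exponents [i.+1] being positive; otherwise
   orthogonality leaves only z = 1/t. *)
have [pa|pa] := boolP (p%:Z %| (a + 1))%Z.
  rewrite /t teich_dvd // mul0r mulr0 big1 // => z _.
  by rewrite big1 ?mul0r // => i _; rewrite mulr0 expr0n.
have t1 : v t = 1 by exact: teich_unit.
have t0 : t != 0 by rewrite -abs_gt0 t1.
have tp : t^-1 ^+ p.-1 = 1 by rewrite exprVn teich_root // invr1.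
have tmem : t^-1 \in teich_seq.
  rewrite -(mem_unity_roots p1 teich_seq_root teich_seq_uniq) ?size_map ?size_iota //.
  exact/unity_rootP.
rewrite (bigD1_seq _ tmem teich_seq_uniq) /=
  [X in _ + X]big_seq_cond [X in _ + X]big1 => [|z /andP[zin zt]].
  under eq_bigr do rewrite mulVf // expr1n.
  rewrite sumr_const card_ord addr0 teichmuller_quo // -/t -subn1 natrB ?prime_gt0 //.
  by congr (_ * _); field; rewrite t0 andbT -abs_gt0 abs_teich_sub ltr01.
rewrite sum_expr_unity_root //; last first.
  have /unity_rootP zp := allP teich_seq_root z zin.
  by rewrite exprMn zp mul1r teich_root.
case: eqP => [zt1|_]; last by rewrite mul0r.
by case/eqP: zt; rewrite -[z](mulfK t0) zt1 mul1r.
Qed.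

End UnityRootSums.

(** * Arc sums over the roots of unity of order a power of p *)

Section ArcSums.
Hypothesis closed : forall P : {poly K}, (1 < size P)%N ->
  (forall i, Qpbar_in v P`_i) -> exists2 x, Qpbar_in v x & root P x.

Lemma Qp_in_int (a : int) : Qp_in v a%:~R.
Proof.
move=> e e0; exists (ratr a%:~R); first by exists a%:~R.
by rewrite ratr_int subrr abs0.
Qed.

Lemma Qpbar_in_int (a : int) : Qpbar_in v a%:~R.
Proof.
exists ('X - (a%:~R)%:P); split; first exact: monic_neq0 (monicXsubC _).
  move=> i; rewrite coefB coefX coefC.
  have -> : (i == 1%N)%:R - (if i == 0%N then a%:~R else 0) =
      ((i == 1%N)%:Z - (if i == 0%N then a else 0))%:~R :> K.
    by rewrite intrB; case: (i == 0%N).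
  exact: Qp_in_int.
by rewrite root_XsubC.
Qed.

(** A root of 1 + X + ... + X^(p-1) is not 1, the value there being p; further p-th roots are then
    extracted. The induction keeps the roots algebraic over Q_p, since [closed] only speaks of
    polynomials with such coefficients. *)
Lemma exists_prim_root k : exists z : K, (p ^ k.+1).-primitive_root z.
Proof.
have p1 := prime_gt1 p_pr; have p0 := prime_gt0 p_pr.
suff [z _ [z1 zN]] : exists2 z : K, Qpbar_in v z &
    z ^+ (p ^ k.+1) = 1 /\ z ^+ (p ^ k) != 1.
  have q0 : (0 < p ^ k.+1)%N by rewrite expn_gt0 p0.
  exists z; have [m zm] := prim_order_exists q0 z1.
  case/(dvdn_pfactor _ _ p_pr)=> i; rewrite leq_eqVlt => /predU1P[-> <- //|ik mE].
  case/eqP: zN; apply/eqP; rewrite -(prim_order_dvd zm) mE.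
  exact: dvdn_exp2l.
elim: k => [|k [w Kw [w1 wN]]].
  have sz : size (\poly_(i < p) (1 : K)) = p by rewrite size_poly_eq // oner_eq0.
  have [||z Kz] := @closed (\poly_(i < p) 1); first by rewrite sz.
    move=> i; rewrite coef_poly; case: ifP => _; [exact: (Qpbar_in_int 1)|exact: (Qpbar_in_int 0)].
  rewrite rootE horner_poly => /eqP z0; exists z => //.
  have {}z0 : \sum_(i < p) z ^+ i = 0.
    by rewrite -[RHS]z0; apply: eq_bigr => i _; rewrite mul1r.
  rewrite !expr1; split; first by apply/eqP; rewrite -subr_eq0 subrX1 z0 mulr0.
  apply/eqP => z1; case/eqP: pK0; rewrite -[RHS]z0 z1.
  by under eq_bigr do rewrite expr1n; rewrite sumr_const card_ord.
have PE : w%:P - 'X^p != 0 :> {poly K}.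
  apply/eqP => /(congr1 (fun P : {poly K} => P`_p)).
  rewrite coefB coefC coefXn coef0 eqxx gtn_eqF // sub0r => /eqP.
  by rewrite oppr_eq0 oner_eq0.
have [||z Kz] := @closed (w%:P - 'X^p).
- apply: leq_trans (_ : p.+1 <= _)%N; first by lia.
  have : (w%:P - 'X^p)`_p != 0 :> K.
    by rewrite coefB coefC coefXn eqxx gtn_eqF // sub0r oppr_eq0 oner_eq0.
  by apply: contraR; rewrite -leqNgt => /leq_sizeP/(_ p (leqnn p))/eqP.
- move=> i; rewrite coefB coefC coefXn; case: eqP => [->|_].
    by rewrite (ltn_eqF p0) subr0.
  case: eqP => _; last by rewrite subr0; exact: (Qpbar_in_int 0).
  by rewrite sub0r; exact: (Qpbar_in_int (-1)).
rewrite rootE !hornerE subr_eq0 => /eqP zw; exists z => //.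
by split; rewrite expnS exprM -zw.
Qed.

(** Modulo p, (y - 1)^p is y^p - 1, so closeness to 1 descends along p-th roots. Hence the nodes 1 -
    z of the arc lie in the open unit disc. *)
Lemma abs_1B_pX_root x k : v x <= 1 -> v (x ^+ (p ^ k) - 1) < 1 -> v (x - 1) < 1.
Proof.
move=> x1; elim: k => [|k IHk]; first by rewrite expr1.
rewrite expnSr exprM; set y := _ ^+ (p ^ k) => yp; apply: IHk; rewrite -/y.
have y1 : v y <= 1 by rewrite absX exprn_ile1 ?abs_ge0.
have d1 : v (y - 1) <= 1 by rewrite absB ?abs1.
have : v ((y - 1) ^+ p) < 1.
  have := @abs_frobenius (y - 1) 1 d1 _; rewrite abs1 lexx => /(_ isT) F.
  have -> : (y - 1) ^+ p = (y ^+ p - 1) -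
      ((y - 1 + 1) ^+ p - (y - 1) ^+ p - 1 ^+ p).
    by rewrite subrK expr1n; ring.
  by apply: absB_lt => //; apply: le_lt_trans F invp_lt1.
by rewrite absX expr_lt1 ?abs_ge0 // prime_gt0.
Qed.

Section ArcSum.
Variables (q : nat) (z : K).
Hypotheses (q0 : (0 < q)%N) (zq : q.-primitive_root z).

Lemma sum_prim_root s : (0 < s <= q)%N ->
  \sum_(i < q) (z ^+ i) ^+ s = if s == q then q%:R else 0.
Proof.
move=> /andP[s0 sq].
under eq_bigr do rewrite exprAC.
have zs : (z ^+ s) ^+ q = 1 by rewrite exprAC (prim_expr_order zq) expr1n.
have [E|sNq] := eqVneq s q.
  under eq_bigr do rewrite E (prim_expr_order zq) expr1n.
  by rewrite sumr_const card_ord.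
have : (z ^+ s - 1) * \sum_(i < q) (z ^+ s) ^+ i = 0 by rewrite -subrX1 zs subrr.
move/eqP; rewrite mulf_eq0 subr_eq0 -(prim_order_dvd zq) => /orP[|/eqP //].
by move/(dvdn_leq s0); lia.
Qed.

(** Expansion produces only exponents from s + 1 to s + 1 + r, none of them divisible by q. *)
Lemma sum_prim_root_mul1B r s : (s.+1 + r < q)%N ->
  \sum_(i < q) (z ^+ i) ^+ s.+1 * (1 - z ^+ i) ^+ r = 0.
Proof.
elim: r s => [|r IHr] s sr.
  under eq_bigr do rewrite expr0 mulr1.
  by rewrite sum_prim_root; [case: eqP => [E|//]; exfalso; lia | lia].
rewrite (_ : \sum_(i < q) _ = \sum_(i < q) (z ^+ i) ^+ s.+1 * (1 - z ^+ i) ^+ r -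
    \sum_(i < q) (z ^+ i) ^+ s.+2 * (1 - z ^+ i) ^+ r).
  by rewrite !IHr ?subrr //; lia.
rewrite -sumrB; apply: eq_bigr => i _.
by rewrite [(z ^+ i) ^+ s.+2]exprS [_ ^+ r.+1]exprS; ring.
Qed.

(* Since (1 - z) u = (1 + (1 - z) u) - 1, the sum for r + 1 is, up to the factor
   - u, the sum for r. *)
Lemma arc_sum_rational (u : K) r : (r.+1 < q)%N -> (1 + u) ^+ q != u ^+ q ->
  (forall i : 'I_q, 1 + (1 - z ^+ i) * u != 0) ->
  \sum_(i < q) z ^+ i * (1 - z ^+ i) ^+ r / (1 + (1 - z ^+ i) * u) =
  (-1) ^+ r * q%:R * u ^+ (q - r.+1) / ((1 + u) ^+ q - u ^+ q).
Proof.
move=> rq D0 d0; have {}D0 : (1 + u) ^+ q - u ^+ q != 0 by rewrite subr_eq0.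
set D := (1 + u) ^+ q - u ^+ q in D0 *.
elim: r rq => [|r IHr] rq.
  (* As (u z^i)^q = u^q, the number D is a multiple of (1 + u) - u z^i with a geometric cofactor.
     Summation over i then keeps only s = q - 1. *)
  have E (i : 'I_q) : z ^+ i * (1 - z ^+ i) ^+ 0 / (1 + (1 - z ^+ i) * u) =
      \sum_(s < q) (1 + u) ^+ (q.-1 - s) * u ^+ s / D * (z ^+ i) ^+ s.+1.
    have ziq : (z ^+ i) ^+ q = 1 by rewrite exprAC (prim_expr_order zq) expr1n.
    have DE : D = (1 + (1 - z ^+ i) * u) *
        \sum_(s < q) (1 + u) ^+ (q.-1 - s) * (u * z ^+ i) ^+ s.
      rewrite (_ : 1 + (1 - z ^+ i) * u = (1 + u) - u * z ^+ i); last by ring.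
      by rewrite -subrXX exprMn ziq mulr1.
    apply: (canLR (mulfK (d0 i))); rewrite expr0 mulr1.
    apply: (mulfI D0); rewrite {1}DE [RHS]mulrA [in RHS]mulr_sumr.
    have -> : \sum_(s < q) D * ((1 + u) ^+ (q.-1 - s) * u ^+ s / D * (z ^+ i) ^+ s.+1)
        = z ^+ i * \sum_(s < q) (1 + u) ^+ (q.-1 - s) * (u * z ^+ i) ^+ s.
      rewrite mulr_sumr; apply: eq_bigr => s _.
      by rewrite exprMn [(z ^+ i) ^+ s.+1]exprS; field.
    by ring.
  rewrite (eq_bigr _ (fun i _ => E i)) exchange_big /=.
  have -> : \sum_(s < q) \sum_(i < q)
        (1 + u) ^+ (q.-1 - s) * u ^+ s / D * (z ^+ i) ^+ s.+1 =
      \sum_(s < q) (1 + u) ^+ (q.-1 - s) * u ^+ s / D *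
        (if s.+1 == q then q%:R else 0).
    by apply: eq_bigr => s _; rewrite -mulr_sumr sum_prim_root ?ltn_ord.
  have q1 : (q.-1 < q)%N by rewrite prednK.
  rewrite (bigD1 (Ordinal q1)) //= prednK //.
  rewrite eqxx subnn big1 ?addr0 => [|s sN]; last first.
    case: eqP => sq; last by rewrite mulr0.
    by case/eqP: sN; apply/val_inj => /=; lia.
  by rewrite !expr0 subn1; ring.
(* The recursion divides by u. At u = 0 the right side is 0 because q > r + 2, and the left side is
   a vanishing power sum. *)
have [u0|u0] := eqVneq u 0.
  rewrite u0 expr0n (_ : (q - r.+2 == 0)%N = false) ?mulr0 ?mul0r; last by lia.
  rewrite -[RHS](@sum_prim_root_mul1B r.+1 0) //; apply: eq_bigr => i _.
  by rewrite mulr0 addr0 divr1.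
apply: (mulfI u0); rewrite mulr_sumr.
have -> : \sum_(i < q) u * (z ^+ i * (1 - z ^+ i) ^+ r.+1 / (1 + (1 - z ^+ i) * u)) =
    (\sum_(i < q) (z ^+ i) ^+ 1 * (1 - z ^+ i) ^+ r) -
    \sum_(i < q) z ^+ i * (1 - z ^+ i) ^+ r / (1 + (1 - z ^+ i) * u).
  rewrite -sumrB; apply: eq_bigr => i _; have di := d0 i.
  by rewrite [_ ^+ r.+1]exprS; field.
rewrite sum_prim_root_mul1B ?IHr; [|lia|lia].
rewrite (_ : q - r.+1 = (q - r.+2).+1)%N; last by lia.
by rewrite !exprS; field.
Qed.

Lemma arc_sumE k (f : K -> K) : q = (p ^ k)%N ->
  arc_sum p 1 0 f k = p%:R ^- k * \sum_(i < q) - z ^+ i * f (1 - z ^+ i).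
Proof.
move=> qE; congr (_ * _); pose rs := [seq z ^+ i | i <- iota 0 q].
rewrite -qE (@fsbig_unity_root q rs) //.
- rewrite big_map -(big_mkord predT (fun i => - z ^+ i * f (1 - z ^+ i))) /index_iota subn0.
  by apply: eq_bigr => i _; rewrite sub0r mulN1r addrAC subrr add0r.
- apply/allP => _ /mapP[i _ ->]; apply/unity_rootP.
  by rewrite exprAC (prim_expr_order zq) expr1n.
- rewrite map_inj_in_uniq ?iota_uniq // => i l; rewrite !mem_iota /= !add0n => iq lq.
  by move/eqP; rewrite (eq_prim_root_expr zq) !modn_small // => /eqP.
- by rewrite size_map size_iota.
Qed.

End ArcSum.

Lemma abs_expX_diff (a : int) k :
  v ((a + 1)%:~R ^+ (p ^ k) - a%:~R ^+ (p ^ k)) = 1.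
Proof.
rewrite (_ : _ - _ = 1 + ((a%:~R - a%:~R ^+ (p ^ k)) -
  ((a + 1)%:~R - (a + 1)%:~R ^+ (p ^ k)))); last by rewrite intrD; ring.
rewrite absD_eq abs1 //; apply: le_lt_trans invp_lt1.
by apply: absB; exact: abs_fermatX.
Qed.

Lemma smooth_intX n : smooth 1 (fun a => a%:~R ^+ n).
Proof. by have := smoothX n smooth_int; rewrite expr1n. Qed.

(** The denominator is a unit for every k, so the constant is uniform in k, as [volkenborn_lim]
    requires. *)
Lemma smooth_arc_kernel k (F : int -> K) : smooth 1 F -> smooth 1 (fun a : int =>
  F a / ((a + 1)%:~R ^+ (p ^ k) - a%:~R ^+ (p ^ k))).
Proof.
move=> sF; rewrite -[1]mul1r; apply: smoothM sF (smoothV _ _) => [|a].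
  apply: smoothB (smooth_intX _).
  exact: (smooth_shift 1 (smooth_intX (p ^ k)%N)).
exact: abs_expX_diff.
Qed.

(** The denominator changes sign and order because q is odd, while the signs of the numerator
    combine to (-1)^(q-1) = 1. *)
Lemma arc_kernel_reflect (q n i : nat) (a b : K) : odd q -> (i + n).+1 = q ->
  - ((-1) ^+ i * ((- b) ^+ n / ((- a) ^+ q - (- b) ^+ q))) =
  - (b ^+ n / (b ^+ q - a ^+ q)).
Proof.
move=> oq inq; have Nq x : (- x) ^+ q = - x ^+ q.
  by rewrite exprNn -signr_odd oq expr1 mulN1r.
have in_even : odd (i + n) = false by move: oq; rewrite -inq /= => /negPf.
rewrite (exprNn b n) !Nq opprK [- _ + _]addrC !mulrA -exprD -signr_odd in_even.
by rewrite expr0 mul1r.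
Qed.

(** * Passage to the limit in k *)

Section Integral.
Variables (lg : K -> K) (j : nat).
Hypotheses (p_odd : odd p) (lgP : iwasawa_log p v lg) (j2 : (2 <= j)%N).

Lemma ltn_pX k : (j <= k)%N -> (j.-1 < p ^ k)%N.
Proof.
move=> jk; apply: leq_ltn_trans (ltn_expl k (prime_gt1 p_pr)).
by rewrite (leq_trans (leq_pred j)).
Qed.

Lemma arc_sum_volkenborn k : (j <= k)%N ->
  volkenborn (fun a => - ((a + 1)%:~R ^+ (p ^ k - j.-1) /
      ((a + 1)%:~R ^+ (p ^ k) - a%:~R ^+ (p ^ k))))
    (arc_sum p 1 0 (integrand p v lg j) k).
Proof.
move=> jk; have jq := ltn_pX jk.
have [z zq] := exists_prim_root k.-1.
rewrite prednK in zq; last by rewrite (leq_trans _ jk) // ltnW.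
set q := (p ^ k)%N in jq zq *; have q0 : (0 < q)%N by exact: leq_ltn_trans jq.
have z1 i : v (1 - z ^+ i) < 1.
  have ziq : (z ^+ i) ^+ q = 1 by rewrite exprAC (prim_expr_order zq) expr1n.
  have vz : v (z ^+ i) <= 1.
    by rewrite le_eqVlt -(@pexpr_eq1 _ _ q) ?abs_ge0 // -absX ziq abs1 eqxx.
  by rewrite absBC (@abs_1B_pX_root _ k) // -/q ziq subrr abs0.
(* The kernel before reflection, as [arc_sum_rational] gives it with r = j - 2; its factor q cancels
   p^(-k). *)
pose G (a : int) := - ((-1) ^+ (j - 2) *
  (a%:~R ^+ (q - j.-1) / ((a + 1)%:~R ^+ q - a%:~R ^+ q))) : K.
have VG : volkenborn G (arc_sum p 1 0 (integrand p v lg j) k).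
  rewrite (arc_sumE q0 zq) //.
  apply: (@volkenborn_ext (fun a => p%:R ^- k * \sum_(i < q) - z ^+ i *
      ((1 - z ^+ i) ^+ (j - 2) / (1 + (1 - z ^+ i) * a%:~R)))) => [n|]; last first.
    apply: volkenbornZ; apply: volkenborn_sum => i _; apply: volkenbornZ.
    exact: integrand_volkenborn.
  have D0 : (1 + n%:~R) ^+ q != n%:~R ^+ q :> K.
    rewrite -subr_eq0 -abs_gt0; have := abs_expX_diff n k.
    by rewrite intrD [_ + 1%:~R]addrC => ->.
  have d0 (i : 'I_q) : 1 + (1 - z ^+ i) * n%:~R != 0.
    rewrite -abs_gt0 absD_eq abs1 // absM.
    by apply: le_lt_trans (z1 i); rewrite ler_piMr ?abs_ge0 ?abs_int.
  have j1q : ((j - 2).+1 < q)%N by rewrite subn2 prednK //; lia.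
  have := arc_sum_rational q0 zq j1q D0 d0.
  under eq_bigr do rewrite -mulrA.
  under [in X in _ -> X]eq_bigr do rewrite mulNr.
  rewrite sumrN mulrN => ->; rewrite /G.
  rewrite (_ : (j - 2).+1 = j.-1); last by lia.
  rewrite intrD [_ + 1]addrC; have := D0; rewrite -subr_eq0 => D0'.
  congr (- _); rewrite -[p%:R ^- k]/((p%:R ^+ k)^-1) -natrX -/q.
  have qK : q%:R != 0 :> K by rewrite abs_nat_neq0.
  by field; rewrite qK D0'.
have sG : smooth 1 G.
  apply: smoothN; have := smoothZ ((-1) ^+ (j - 2)) (smooth_arc_kernel k (smooth_intX (q - j.-1))).
  by rewrite absX absN abs1 expr1n mul1r.
apply: volkenborn_ext (volkenborn_reflect sG VG) => n; rewrite /G.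
have qodd : odd q by rewrite /q oddX p_odd orbT.
set b : K := (n%:Z + 1)%:~R; set a : K := n%:~R.
have -> : (- n%:Z - 1)%:~R = - b :> K by rewrite /b -mulrNz opprD.
have -> : (- n%:Z - 1 + 1)%:~R = - a :> K by rewrite subrK mulrNz.
by rewrite arc_kernel_reflect //; lia.
Qed.

Lemma arc_integral (L : nat -> K) :
  (forall i : 'I_p.-1, volkenborn (fun a =>
     teich (a + 1) ^+ i.+1 / (a + 1)%:~R ^+ j.-1) ((j%:R - 1) * L i)) ->
  is_arc_integral v p 1 0 (integrand p v lg j)
    ((1 - j%:R) / (p%:R - 1) * \sum_(i < p.-1) delta p v i * L i).
Proof.
(* Dropping the first j arc sums ensures j - 1 < p^k, so that the subtraction in the exponent is not
   truncated. *)
move=> HL; apply/(vcvg_shift j).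
have p1 : p%:R - 1 != 0 :> K.
  by rewrite -(natrB _ (prime_gt0 p_pr)) abs_nat_neq0 // subn_gt0 prime_gt1.
have smth k : smooth 1 (fun a => - ((a + 1)%:~R ^+ (p ^ k - j.-1) /
    ((a + 1)%:~R ^+ (p ^ k) - a%:~R ^+ (p ^ k)))).
  apply/smoothN/smooth_arc_kernel.
  exact: (smooth_shift 1 (smooth_intX (p ^ k - j.-1)%N)).
pose G (a : int) := - (teich (a + 1) / (a + 1)%:~R ^+ j.-1 /
  (teich (a + 1) - teich a)).
have t0 (a : int) : teich (a + 1) - teich a != 0.
  by rewrite -abs_gt0 abs_teich_sub.
have FG (a : int) : vcvg v (fun k => - ((a + 1)%:~R ^+ (p ^ (k + j) - j.-1) /
    ((a + 1)%:~R ^+ (p ^ (k + j)) - a%:~R ^+ (p ^ (k + j))))) (G a).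
  have tj b := (vcvg_shift j _ _).2 (teich_cvg b).
  apply/vcvgN/vcvgM; last by apply/vcvgV/vcvgB.
  apply: (@vcvg_ext (fun k => (a + 1)%:~R ^+ (p ^ (k + j)) / (a + 1)%:~R ^+ j.-1)).
    move=> k; have jq := ltn_pX (leq_addl k j).
    (* At a + 1 = 0 the quotient of powers cannot be simplified, but both sides are 0 since the
       exponents are positive. *)
    have [->|b0] := eqVneq ((a + 1)%:~R : K) 0; last by rewrite expfB.
    have [q0 d0] : (0 < p ^ (k + j))%N /\ (0 < p ^ (k + j) - j.-1)%N by lia.
    by rewrite !expr0n (gtn_eqF q0) (gtn_eqF d0) mul0r.
  exact: vcvgM (tj _) (vcvg_cst _).
have IG : volkenborn G
    ((1 - j%:R) / (p%:R - 1) * \sum_(i < p.-1) delta p v i * L i).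
  (* The L-value integrals are combined with weights delta_i; by [sum_delta] the integrands add up
     to [G], the factor p - 1 cancelling. *)
  have H := volkenbornZ (- (p%:R - 1)^-1) (volkenborn_sum (index_enum 'I_p.-1)
    (fun i (_ : predT i) => volkenbornZ (delta p v i) (HL i))).
  rewrite (_ : _ * _ = - (p%:R - 1)^-1 *
      \sum_(i < p.-1) delta p v i * ((j%:R - 1) * L i)); last first.
    rewrite !mulr_sumr; apply: eq_bigr => i _; by field.
  apply: volkenborn_ext H => n; rewrite /G.
  under eq_bigr do rewrite mulrA.
  rewrite -mulr_suml sum_delta; have t0n := t0 n.
  by move: (_ ^+ j.-1)^-1 => c; field; rewrite ?p1 ?t0n.
exact: volkenborn_lim (fun k => smth (k + j)%N) FG
  (fun k => arc_sum_volkenborn (leq_addl k j)) IG.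
Qed.

End Integral.
End ArcSums.

End Nonarchimedean.

Theorem theorem5p29 (R : realType) (p j : nat) (Cp : fieldType) (v : Cp -> R)
    (lg : Cp -> Cp) (Lp : Cp -> (int -> Cp) -> Cp) :
  prime p -> odd p -> (2 <= j)%N ->
  is_Cp p v ->
  iwasawa_log p v lg ->
  (forall (N : nat) (chi : int -> Cp), dirichlet_character N chi ->
     kubota_leopoldt p v chi (fun s => Lp s chi)) ->
  is_arc_integral v p 1 0 (integrand p v lg j)
    ((1 - j%:R) / (p%:R - 1) *
     \sum_(i < p.-1) delta p v i *
       Lp j%:R (omega_pow p v (i%:Z - j%:Z + 2))).
Proof.
move=> p_pr p_odd j2 [vP complete closed _] lgP KL.
apply: (arc_integral p_pr vP complete closed p_odd lgP j2
  (L := fun i => Lp j%:R (omega_pow p v (i%:Z - j%:Z + 2)))) => i.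
(* With e = i + 1 the exponent takes the form e - j + 1 of [KL_positive], and e runs over 1, ..., p
   - 1. *)
have -> : i%:Z - j%:Z + 2 = i.+1%:Z - j%:Z + 1 by lia.
apply: (KL_positive p_pr vP complete j2 _ (KL _ _ _)); first by rewrite ltn_ord.
exact: (omega_pow_dirichlet p_pr vP complete).
Qed.
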